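(* Let $n\ge1$ be an integer, let $\alpha\ge2$ be an even integer with $\alpha\ne4$, set $D=2n+1$, and let $c>0$ be the fixed constant in the definition of the truncated lattice $L_{D,Q}$. There is a constant $K>0$, depending only on $D$ and $\phi_\alpha$ (and on the fixed constant $c$), such that for every $\delta\in(0,1)$ and every $Q\in\mathbb{N}$, $Q\geq 1$, $$Q^{-(2n+2)}\,\#\{(u,v)\in L_{D,Q}\times L_{D,Q}: |\phi_\alpha(u,v)-Q|\le\delta\}\ \le\ \begin{cases}K\max\{Q^{2n},\,Q^{2n+1}\delta\}, & \alpha=2,\\[2pt] K\max\{Q^{2n+\frac{2}{D}},\,Q^{2n+1}\delta\}, & \alpha\ge6.\end{cases}$$
   Context: Write points of $\mathbb{R}^D=\mathbb{R}^{2n}\times\mathbb{R}$ as $x=(\underline{x},\bar{x})$ with $\underline{x}\in\mathbb{R}^{2n}$, $\bar{x}\in\mathbb{R}$. Let $J=\begin{pmatrix}0&I_n\\-I_n&0\end{pmatrix}$ be the $2n\times 2n$ standard symplectic matrix. The Heisenberg group law is $x*y=(\underline{x}+\underline{y},\ \bar{x}+\bar{y}+\tfrac12\underline{x}^{\intercal}J\underline{y})$, so $y^{-1}=-y$. For each $\alpha$, set $\|x\|_\alpha=(|\underline{x}|^\alpha+C_\alpha|\bar{x}|^{\alpha/2})^{1/\alpha}$ ($|\cdot|$ Euclidean), where $C_\alpha>0$ is a fixed constant chosen so that $\|x*y\|_\alpha\le\|x\|_\alpha+\|y\|_\alpha$ for all $x,y$, and $$\phi_\alpha(x,y)=\|x*y^{-1}\|_\alpha=\Big(|\underline{x}-\underline{y}|^\alpha+C_\alpha\big|\bar{x}-\bar{y}+\tfrac12\underline{y}^{\intercal}J\underline{x}\big|^{\alpha/2}\Big)^{1/\alpha}.$$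 For a fixed constant $c>0$, the truncated lattice is $$L_{D,Q}=\{b=(b_1,\dots,b_D)\in\mathbb{Z}^D: |b_i|\le cQ \text{ for } 1\le i\le D-1,\ |b_D|\le cQ^2\}.$$ *)

(* Defs.v *)
From HB Require Import structures.
From mathcomp Require Import all_boot all_order all_algebra finmap.
From mathcomp Require Import all_classical all_reals all_analysis.
From mathcomp Require Import zify ring lra.
Set Implicit Arguments.
Unset Strict Implicit.
Unset Printing Implicit Defensive.
Import Order.TTheory GRing.Theory Num.Theory.
Local Open Scope classical_set_scope.
Local Open Scope ring_scope.

Section Heisenberg.
Context {R : realType} {n : nat}.

Implicit Types x y : 'cV[R]_(n + n + 1).

Definition hpart x : 'cV[R]_(n + n) := usubmx x.

Definition vpart x : R := dsubmx x 0 0.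

Definition Jmx : 'M[R]_(n + n) := block_mx 0 1%:M (- 1%:M) 0.

(* The norm that the library puts on matrices is the sup norm. *)
Definition eucl_norm m (v : 'cV[R]_m) : R := Num.sqrt (\sum_i v i 0 ^+ 2).

Definition hmul x y : 'cV[R]_(n + n + 1) :=
  col_mx (hpart x + hpart y)
    (const_mx (vpart x + vpart y
               + 2^-1 * ((hpart x)^T *m Jmx *m hpart y) 0 0)).

Definition hinv x : 'cV[R]_(n + n + 1) := - x.

Definition hnorm (alpha C : R) x : R :=
  (eucl_norm (hpart x) `^ alpha + C * `|vpart x| `^ (alpha / 2)) `^ alpha^-1.

Definition phi (alpha C : R) x y : R := hnorm alpha C (hmul x (hinv y)).

Definition lattice (c : R) (Q : nat) : set 'cV[int]_(n + n + 1) :=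
  [set b | (forall i, `|usubmx b i 0|%:~R <= c * Q%:R)
           /\ `|dsubmx b 0 0|%:~R <= c * Q%:R ^+ 2].

Definition near_pairs (alpha C c : R) (Q : nat) (delta : R) :
    set ('cV[int]_(n + n + 1) * 'cV[int]_(n + n + 1)) :=
  [set p | [/\ lattice c Q p.1, lattice c Q p.2 &
    `|phi alpha C (map_mx intr p.1) (map_mx intr p.2) - Q%:R| <= delta]].

Lemma hpartM x y : hpart (hmul x y) = hpart x + hpart y.
Proof. by rewrite /hpart /hmul col_mxKu. Qed.

Lemma vpartM x y : vpart (hmul x y) =
  vpart x + vpart y + 2^-1 * ((hpart x)^T *m Jmx *m hpart y) 0 0.
Proof. by rewrite /vpart /hmul col_mxKd mxE. Qed.

Lemma hpartV x : hpart (hinv x) = - hpart x.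
Proof. by apply/matrixP => i j; rewrite !mxE. Qed.

Lemma vpartV x : vpart (hinv x) = - vpart x.
Proof. by rewrite /vpart /hinv !mxE. Qed.

Lemma JmxT : Jmx^T = - Jmx.
Proof.
by rewrite /Jmx tr_block_mx !trmx0 !linearN /= trmx1 opp_block_mx opprK !oppr0.
Qed.

Lemma sympl_skew (u v : 'cV[R]_(n + n)) :
  (u^T *m Jmx *m v) 0 0 = - (v^T *m Jmx *m u) 0 0.
Proof.
rewrite -[in LHS](trmxK (u^T *m Jmx *m v)) mxE !trmx_mul trmxK JmxT.
by rewrite mulNmx mulmxN mxE mulmxA.
Qed.

Lemma phiE (alpha C : R) x y : phi alpha C x y =
  (eucl_norm (hpart x - hpart y) `^ alpha
   + C * `|vpart x - vpart y + 2^-1 * ((hpart y)^T *m Jmx *m hpart x) 0 0|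
         `^ (alpha / 2)) `^ alpha^-1.
Proof.
rewrite /phi /hnorm hpartM vpartM hpartV vpartV mulmxN mxE.
by rewrite (sympl_skew (hpart x)) opprK.
Qed.

Lemma hmulxV x : hmul x (hinv x) = 0.
Proof.
have s0 : ((hpart x)^T *m Jmx *m hpart x) 0 0 = 0.
  by have := sympl_skew (hpart x) (hpart x); lra.
apply/matrixP => i j.
rewrite -[hmul _ _]vsubmxK -/(hpart _) hpartM hpartV subrr !mxE.
case: splitP => k _; first by rewrite mxE.
by rewrite (ord1 k) (ord1 j) -/(vpart _) vpartM vpartV hpartV mulmxN mxE s0; lra.
Qed.

Lemma finite_lattice (c : R) (Q : nat) : finite_set (lattice c Q).
Proof.
pose M := maxn (Num.truncn (c * Q%:R)) (Num.truncn (c * Q%:R ^+ 2)).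
pose f (A : 'cV['I_(M + M).+1]_(n + n + 1)) : 'cV[int]_(n + n + 1) :=
  map_mx (fun k : 'I_(M + M).+1 => k%:Z - M%:Z) A.
apply: (@sub_finite_set _ _ (f @` setT)); last first.
  by apply: finite_image; exact: finite_finset.
have bnd (z : int) (r : R) : `|z|%:~R <= r -> (absz z <= Num.truncn r)%N.
  move=> h; rewrite truncn_ge_nat; last by rewrite (le_trans _ h) // ler0z.
  by rewrite (le_trans _ h) // natr_absz.
move=> b [hu hd].
have hb i : (absz (b i 0%R) <= M)%N.
  rewrite leq_max; case: (split_ordP i) => k ->.
    by have := hu k; rewrite mxE => /bnd ->.
  by have := hd; rewrite mxE (ord1 k) => /bnd ->; rewrite orbT.
exists (\col_i inord (absz (b i 0 + M%:Z))) => //.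
apply/matrixP => i j; rewrite (ord1 j) !mxE.
have := hb i; move: (b i 0) => z hz.
have z0 : 0 <= z + M%:Z by lia.
by rewrite inordK; lia.
Qed.

Lemma finite_near_pairs (alpha C c : R) (Q : nat) (delta : R) :
  finite_set (near_pairs alpha C c Q delta).
Proof.
apply: (@sub_finite_set _ _ (lattice c Q `*` lattice c Q)).
  by move=> p [].
by apply: finite_setX; exact: finite_lattice.
Qed.

End Heisenberg.

(* Hence subadditivity of the gauge can only be assumed for other exponents. *)
Lemma hnorm2_not_subadditive (R : realType) (n : nat) (C : R) :
  (0 < n)%N -> 0 < C ->
  ~ forall x y : 'cV[R]_(n + n + 1),
      hnorm 2 C (hmul x y) <= hnorm 2 C x + hnorm 2 C y.
Proof.
case: n => // n _ C0 tri.
have [e [e0 eC]] : exists e : R, 0 < e /\ e <= C / 4.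
  by exists (C / 4); rewrite divr_gt0.
pose a : 'cV[R]_n.+1 := delta_mx 0 0.
have aa : a^T *m a = 1%:M.
  by rewrite trmx_delta mul_delta_mx; apply/matrixP => i j; rewrite !ord1 !mxE.
have normE (u v : 'cV[R]_n.+1) :
    eucl_norm (col_mx u v) `^ 2 = (u^T *m u) 0 0 + (v^T *m v) 0 0.
  rewrite powR_mulrn ?sqrtr_ge0 // sqr_sqrtr; last first.
    by apply: sumr_ge0 => i _; exact: sqr_ge0.
  rewrite big_split_ord /= !mxE; congr (_ + _); apply: eq_bigr => i _.
    by rewrite col_mxEu !mxE.
  by rewrite col_mxEd !mxE.
pose x : 'cV[R]_(n.+1 + n.+1 + 1) := col_mx (col_mx a 0) 0.
pose y : 'cV[R]_(n.+1 + n.+1 + 1) := col_mx (col_mx a (e *: a)) 0.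
have hx : hpart x = col_mx a 0 by exact: col_mxKu.
have hy : hpart y = col_mx a (e *: a) by exact: col_mxKu.
have vx : vpart x = 0 by rewrite /vpart col_mxKd mxE.
have vy : vpart y = 0 by rewrite /vpart col_mxKd mxE.
have om : ((hpart x)^T *m Jmx *m hpart y) 0 0 = e.
  rewrite hx hy /Jmx tr_col_mx trmx0 mul_row_block mul_row_col.
  rewrite !mul0mx !mulmx0 !mulmx1 !addr0 mul0mx add0r -scalemxAr aa.
  by rewrite !mxE mulr1.
have {}tri := tri x y.
have h0 (t : R) : `|t| `^ (2 / 2) = `|t| by rewrite divff // powRr1.
have := tri; rewrite /hnorm hpartM vpartM om vx vy hx hy !h0 add_col_mx add0r.
rewrite !normE !normr0 !mulr0 !addr0 add0r.
have -> : ((a + a)^T *m (a + a)) 0 0 = 4.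
  by rewrite [(a + a)^T]linearD /= mulmxDl !mulmxDr aa !mxE /= -!natrD.
have -> : ((e *: a)^T *m (e *: a)) 0 0 = e ^+ 2.
  by rewrite [(e *: a)^T]linearZ /= -scalemxAr -scalemxAl aa !mxE /= mulr1 expr2.
rewrite aa trmx0 mul0mx !mxE /= addr0 powR1.
have q0 : 0 < 1 + e ^+ 2 by rewrite ltr_pwDl ?ltr01 ?sqr_ge0.
have l0 : 0 <= 4 + e ^+ 2 + C * `|2^-1 * e|.
  by rewrite !addr_ge0 ?sqr_ge0 // mulr_ge0 // ltW.
rewrite !powR12_sqrt //; last exact: ltW.
set s : R := Num.sqrt (1 + e ^+ 2) => h.
have s0 : 0 <= s by exact: sqrtr_ge0.
have s2 : s ^+ 2 = 1 + e ^+ 2 by rewrite sqr_sqrtr // ltW.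
have : 4 + e ^+ 2 + C * `|2^-1 * e| <= (1 + s) ^+ 2.
  rewrite -[leLHS]sqr_sqrtr // ler_sqr // nnegrE ?sqrtr_ge0 //.
  exact: addr_ge0.
rewrite gtr0_norm; last by rewrite mulr_gt0 // invr_gt0.
have ss : s <= 1 + e ^+ 2 / 2.
  rewrite -ler_sqr ?nnegrE //; last by rewrite addr_ge0 // divr_ge0 ?sqr_ge0.
  have := sqr_ge0 (e ^+ 2); rewrite s2.
  by move: (e ^+ 2); clear => w w0; nra.
have ee : e ^+ 2 <= e * (C / 4) by rewrite expr2 ler_pM2l.
have eC0 : 0 < C * e by exact: mulr_gt0.
rewrite sqrrD s2 expr1n mul1r.
move: (e ^+ 2) (s : R) ss ee eC0 {s0 s2 h l0 q0}; clear => w t ss ee eC0; lra.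
Qed.

(* Main.v *)
Require Import Defs.
From HB Require Import structures.
From mathcomp Require Import all_boot all_order all_algebra finmap.
From mathcomp Require Import all_classical all_reals all_analysis.
From mathcomp Require Import zify ring lra.

(** For fixed [v] the pair [(u, v)] is determined by the horizontal difference
    [k] and by twice the vertical coordinate [m] of [u * v^-1], both integral;
    so it is enough to bound by [O(Q^(2n) (1 + delta Q))] the number of integral
    [(k, m)] with [| |k|^(2b) + C' |m|^b - Q^(2b) | <= A delta Q^(2b-1)], where
    [alpha = 2b].  Cut this set dyadically by [|m| ~ Q^2 / w].  As long as
    [w^b <= Q], the vectors [k] fill a shell containing [O(Q^(2n) / w^b)] lattice
    points, and each of them leaves [O(1 + delta Q w^(b-1))] values of [m]: the
    sum over [w] is geometric.  The remaining [|m| <= Q^2 / z], with [z^b ~ Q],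
    are fixed first: then [|k|^2] takes [O(1 + delta Q)] values, each reached
    [O(Q^(2n-2) z)] times, because a number has few representations as a sum of
    two squares, by the divisor bound. *)

(** * The divisor bound *)

Lemma size_divisors_dvd (m n : nat) : 0 < n -> m %| n ->
  size (divisors m) <= size (divisors n).
Proof.
move=> n0 mn; apply: uniq_leq_size; first exact: divisors_uniq.
move=> d; rewrite -!dvdn_divisors ?(dvdn_gt0 n0) // => /dvdn_trans; exact.
Qed.

(** A divisor of [n] is determined by its [p]-adic valuation and its prime-to-[p] part, which
    divides that of [n]. *)
Lemma size_divisors_pfactor (p n : nat) : prime p -> 0 < n ->
  size (divisors n) <= (logn p n).+1 * size (divisors n`_p^').
Proof.
move=> pp n0.
rewrite -[leqLHS](size_map (fun d => (logn p d, d`_p^'))).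
have : size [seq (i, d) | i <- iota 0 (logn p n).+1, d <- divisors n`_p^']
  = (logn p n).+1 * size (divisors n`_p^') by rewrite size_allpairs size_iota.
move=> <-; apply: uniq_leq_size.
  rewrite map_inj_in_uniq ?divisors_uniq // => x y.
  rewrite -!dvdn_divisors // => xn yn [e f].
  have [x0 y0] := (dvdn_gt0 n0 xn, dvdn_gt0 n0 yn).
  by rewrite -(partnC p x0) -(partnC p y0) !p_part e f.
move=> _ /mapP[d + ->]; rewrite -dvdn_divisors // => dn.
apply/allpairsP; exists (logn p d, d`_p^'); split=> //.
  by rewrite mem_iota add0n ltnS dvdn_leq_log.
by rewrite -dvdn_divisors ?part_gt0 // partn_dvd.
Qed.

Lemma expn_le_exp2 (k : nat) : 0 < k ->
  forall e, e.+1 ^ k <= (2 * k) ^ k * 2 ^ e.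
Proof.
(* with [q = e %/ k], [e + 1 <= k (q + 1) <= k 2 ^ q] *)
move=> k0 e; set q := e %/ k.
have h : e.+1 <= (2 * k) * 2 ^ q.
  have := ltn_ceil e k0; have := ltn_expl q (leqnn 2); rewrite -/q => h1 h2; nia.
apply: (@leq_trans ((2 * k * 2 ^ q) ^ k)); first by rewrite leq_exp2r.
by rewrite expnMn leq_mul2l -expnM leq_exp2l // leq_trunc_div orbT.
Qed.

(* Only the primes below [2 ^ k] cost a constant: [(e + 1) ^ k <= p ^ e] for the
   other ones. *)
Lemma divisor_bound_aux (k n : nat) : 0 < k -> 0 < n ->
  size (divisors n) ^ k
    <= ((2 * k) ^ k) ^ (count (fun p => p < 2 ^ k) (primes n)) * n.
Proof.
move=> k0; elim/ltn_ind: n => n IH n0.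
have [->|n1] := eqVneq n 1; first by rewrite exp1n.
have {n1} n1 : 1 < n by lia.
set p := pdiv n; have pp : prime p by exact: pdiv_prime.
have pn : p %| n by exact: pdiv_dvd.
set e := logn p n; set m := n`_p^'.
have en : n = p ^ e * m by rewrite -p_part partnC.
have e0 : 0 < e by rewrite logn_gt0 mem_primes pp n0.
have m0 : 0 < m by rewrite part_gt0.
have mn : m < n.
  rewrite en -[ltnLHS]mul1n ltn_pmul2r //; apply: (leq_trans (prime_gt1 pp)).
  by rewrite -[leqLHS]expn1 leq_exp2l // prime_gt1.
have [psm|psm] := boolP (p < 2 ^ k).
(* [p] no longer divides [m], so the count drops and pays for one factor [(2 * k) ^ k]. *)
- have cnt : (count (fun p => p < 2 ^ k) (primes m)).+1
      <= count (fun p => p < 2 ^ k) (primes n).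
    rewrite primes_part -!size_filter.
    rewrite -[leqLHS]/(size (p :: _)); apply: uniq_leq_size.
      by rewrite /= !filter_uniq ?primes_uniq // !mem_filter !inE eqxx /= andbF.
    move=> x; rewrite inE !mem_filter => /orP[/eqP ->|]; last by case/and3P=> -> _ ->.
    by rewrite psm mem_primes pp n0.
  apply: (@leq_trans ((e.+1 * size (divisors m)) ^ k)).
    by rewrite leq_exp2r // size_divisors_pfactor.
  rewrite expnMn.
  apply: (@leq_trans ((2 * k) ^ k * 2 ^ e *
     (((2 * k) ^ k) ^ count (fun p => p < 2 ^ k) (primes m) * m))).
    by rewrite leq_mul // ?expn_le_exp2 // IH.
  rewrite mulnACA -expnS leq_mul //.
    by rewrite leq_pexp2l // expn_gt0; lia.
  by rewrite [leqRHS]en leq_mul2r leq_exp2r // prime_gt1 // orbT.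
have cnt : count (fun p => p < 2 ^ k) (primes m)
    <= count (fun p => p < 2 ^ k) (primes n).
  rewrite primes_part -!size_filter; apply: uniq_leq_size.
    by rewrite !filter_uniq ?primes_uniq.
  by move=> x; rewrite !mem_filter => /and3P[-> _ ->].
apply: (@leq_trans ((e.+1 * size (divisors m)) ^ k)).
  by rewrite leq_exp2r // size_divisors_pfactor.
rewrite expnMn.
apply: (@leq_trans (p ^ e *
   (((2 * k) ^ k) ^ count (fun p => p < 2 ^ k) (primes m) * m))).
  rewrite leq_mul ?IH //.
  apply: (@leq_trans ((2 ^ k) ^ e)); last by rewrite leq_exp2r // leqNgt.
  by rewrite -expnM mulnC expnM leq_exp2r // ltn_expl.
rewrite mulnA [p ^ e * _]mulnC -mulnA -en leq_mul // leq_pexp2l // expn_gt0; lia.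
Qed.

(** At most [2 ^ k] primes lie below [2 ^ k], whatever [n] is, so the constant is uniform. The power
    [k] expresses a bound [O(n ^ (1 / k))] within the naturals. *)
Lemma divisor_bound (k : nat) : 0 < k ->
  exists2 c, 0 < c & forall n, 0 < n -> size (divisors n) ^ k <= c * n.
Proof.
move=> k0; exists (((2 * k) ^ k) ^ (2 ^ k)).
  by rewrite !expn_gt0 muln_gt0 k0.
move=> n n0; apply: (leq_trans (@divisor_bound_aux k n k0 n0)).
rewrite leq_mul2r; apply/orP; right; apply: leq_pexp2l.
  by rewrite expn_gt0; lia.
rewrite -size_filter -[leqRHS](size_iota 0); apply: uniq_leq_size.
  by rewrite filter_uniq ?primes_uniq.
by move=> x; rewrite mem_filter mem_iota add0n => /andP[].
Qed.

Set Implicit Arguments.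
Unset Strict Implicit.
Unset Printing Implicit Defensive.
Import Order.TTheory GRing.Theory Num.Theory.
Local Open Scope classical_set_scope.
Local Open Scope ring_scope.

(** * Counting by duplicate-free lists *)

Section Atmost.
Context {R : realType}.

(** The bound is real and is tested on duplicate-free lists, so that estimates can be combined
    before any finiteness is established. *)
Definition atmost (T : eqType) (A : set T) (r : R) :=
  forall s : seq T, uniq s -> (forall x, x \in s -> A x) -> (size s)%:R <= r.

Implicit Types T U : eqType.

Lemma atmost_le {T} {A : set T} {q : R} (B : set T) {r : R} :
  atmost B r -> A `<=` B -> r <= q -> atmost A q.
Proof.
by move=> hB AB rq s us sA; apply: le_trans rq; apply: hB => // x /sA /AB.
Qed.

Lemma atmost_fset {T : choiceType} (A : set T) (r : R) :
  finite_set A -> atmost A r -> (#|` fset_set A|)%:R <= r.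
Proof.
by move=> fA; apply; rewrite ?fset_uniq // => x; rewrite in_fset_set // inE.
Qed.

Lemma atmost_inj {T U} {f : T -> U} {A : set T} {B : set U} {r : R} :
  (forall x, A x -> B (f x)) ->
  (forall x y, A x -> A y -> f x = f y -> x = y) ->
  atmost B r -> atmost A r.
Proof.
move=> fB fI hB s us sA; rewrite -(size_map f); apply: hB.
  by rewrite map_inj_in_uniq // => x y /sA Ax /sA Ay; exact: fI.
by move=> _ /mapP[x /sA Ax ->]; exact: fB.
Qed.

(** Double counting: the list is sorted by the value of [f], and the count is additive over the
    distinct values. *)
Lemma atmost_fiber {T U} (f : T -> U) {A : set T} {B : set U} {r q : R} :
  0 <= q -> (forall x, A x -> B (f x)) -> atmost B r ->
  (forall u, B u -> atmost [set x | A x /\ f x = u] q) -> atmost A (r * q).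
Proof.
move=> q0 fB hB hF s us sA.
have key : forall t : seq U, uniq t -> (forall u, u \in t -> B u) ->
    (count (fun x => f x \in t) s)%:R <= (size t)%:R * q.
  elim=> [|u t IH] /=; first by rewrite mul0r (@eq_count _ _ pred0) ?count_pred0.
  move=> /andP[ut uu] tB.
  rewrite (@eq_count _ _ (predU (fun x => f x == u) (fun x => f x \in t))); last first.
    by move=> x; rewrite /= inE.
  apply: (@le_trans _ _ ((count (fun x => f x == u) s)%:R
                        + (count (fun x => f x \in t) s)%:R)).
    rewrite -natrD ler_nat.
    rewrite -(count_predUI (fun x => f x == u) (fun x => f x \in t)).
    exact: leq_addr.
  rewrite -addn1 natrD mulrDl mul1r addrC lerD //.
    by apply: IH => // v vt; apply: tB; rewrite inE vt orbT.
  rewrite -size_filter; apply: (hF u); first by apply: tB; rewrite mem_head.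
    exact: filter_uniq.
  by move=> x; rewrite mem_filter => /andP[/eqP fx /sA].
have /key : uniq (undup (map f s)) by exact: undup_uniq.
have sub u : u \in undup (map f s) -> B u.
  by rewrite mem_undup => /mapP[x /sA Ax ->]; exact: fB.
move=> /(_ sub); rewrite (@eq_in_count _ _ predT) ?count_predT.
  by move/le_trans; apply; rewrite ler_wpM2r // hB // undup_uniq.
by move=> x xs /=; rewrite mem_undup map_f.
Qed.

Lemma atmostU {T} {A B : set T} {r q : R} :
  atmost A r -> atmost B q -> atmost (A `|` B) (r + q).
Proof.
move=> hA hB s us sAB.
rewrite -(count_predC (fun x => `[< A x >]) s) natrD -!size_filter lerD //.
  apply: hA; rewrite ?filter_uniq // => x; rewrite mem_filter.
  by case/andP => /asboolP.
apply: hB; rewrite ?filter_uniq // => x; rewrite mem_filter /=.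
by case/andP => /asboolP nA /sAB[].
Qed.

Lemma atmost0 {T} : atmost (@set0 T) 0.
Proof. by move=> [|x s] _ // /(_ x (mem_head _ _)). Qed.

Lemma atmost_bigU {T U} (t : seq U) (F : U -> set T) (r : U -> R) :
  (forall i, i \in t -> atmost (F i) (r i)) ->
  atmost [set x | exists2 i, i \in t & F i x] (\sum_(i <- t) r i).
Proof.
elim: t => [|j t IH] hF.
  by rewrite big_nil; apply: (atmost_le atmost0) => // x [].
have hF' i : i \in t -> atmost (F i) (r i).
  by move=> it; apply: hF; rewrite inE it orbT.
rewrite big_cons.
apply: (atmost_le (atmostU (hF j (mem_head _ _)) (IH hF'))) => //.
move=> x [i]; rewrite inE => /orP[/eqP ->|it Fx]; first by left.
by right; exists i.
Qed.

(** Subtracting the least element of the list gives distinct naturals not exceeding the truncation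
    of [L]. *)
Lemma atmost_int {A : set int} {L : R} : 0 <= L ->
  (forall x y, A x -> A y -> `|x - y|%:~R <= L) -> atmost A (1 + L).
Proof.
move=> L0 hA [|x0 s0]; first by rewrite addr_ge0.
set s := x0 :: s0 => us sA.
have [m ms mle] : exists2 m, m \in s & forall x, x \in s -> m <= x.
  have : exists z, z \in s by exists x0; rewrite mem_head.
  rewrite {us sA}/s; elim: s0 x0 => [|y s IH] x0 _.
    by exists x0; rewrite ?mem_head // => x; rewrite inE => /eqP ->.
  have [|m ms mle] := IH y; first by exists y; rewrite mem_head.
  have [mx|/ltW xm] := leP m x0.
    exists m; first by rewrite inE ms orbT.
    by move=> x; rewrite inE => /orP[/eqP ->|/mle].
  exists x0; first by rewrite mem_head.
  by move=> x; rewrite inE => /orP[/eqP ->|/mle] //; exact: le_trans.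
pose g x := absz (x - m).
have ug : uniq (map g s).
  by rewrite map_inj_in_uniq // => x y /mle + /mle; rewrite /g; lia.
have : {subset map g s <= iota 0 (Num.truncn L).+1}.
  move=> _ /mapP[x xs ->]; rewrite mem_iota /= add0n ltnS truncn_ge_nat //.
  by have := hA _ _ (sA _ xs) (sA _ ms); rewrite -natr_absz.
move/(uniq_leq_size ug); rewrite size_iota size_map => h.
apply: (@le_trans _ _ (Num.truncn L).+1%:R); first by rewrite ler_nat.
by rewrite -addn1 natrD addrC lerD2l truncn_le.
Qed.

Lemma atmost_int_ball (N : R) : 0 <= N ->
  atmost [set z : int | `|z|%:~R <= N] (1 + 2 * N).
Proof.
move=> N0; apply: atmost_int => [|x y hx hy]; first by rewrite mulr_ge0.
have : `|x - y|%:~R <= (`|x| + `|y|)%:~R :> R by rewrite ler_int ler_normB.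
by move/le_trans; apply; rewrite intrD mulr2n mulrDl mul1r lerD.
Qed.

Lemma atmost_bool (A : set bool) : atmost A 2.
Proof.
move=> s us _; rewrite ler_nat -card_bool.
by rewrite -(card_uniqP us); exact: max_card.
Qed.

(** Among integers of the same sign the absolute value preserves distances, so [atmost_int] applies
    to each of the two sign classes. *)
Lemma atmost_int_abs {A : set int} {L : R} : 0 <= L ->
  (forall x y, A x -> A y -> `| `|x|%:~R - `|y|%:~R | <= L) ->
  atmost A (2 * (1 + L)).
Proof.
move=> L0 hA; apply: (@atmost_fiber _ _ (fun x : int => 0 <= x) A setT 2 (1 + L)) => //.
- by rewrite addr_ge0.
- exact: atmost_bool.
move=> u _; apply: atmost_int => // x y [Ax xu] [Ay yu].
apply: le_trans (hA _ _ Ax Ay).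
by rewrite -intrB -intr_norm ler_int; move: yu; rewrite -xu; lia.
Qed.

Lemma atmost_seq {T} (s : seq T) (A : set T) :
  (forall x, A x -> x \in s) -> atmost A (size s)%:R.
Proof. by move=> h t ut tA; rewrite ler_nat uniq_leq_size // => x /tA /h. Qed.

(** This permits fixing a reference element of [A]: the empty set satisfies any nonnegative
    bound. *)
Lemma atmost_pick {T} (A : set T) (r : R) : 0 <= r ->
  (forall x, A x -> atmost A r) -> atmost A r.
Proof.
by move=> r0 h [|x s] // u sA; apply: (h x) => //; apply: sA; rewrite mem_head.
Qed.

End Atmost.

(** * Sums of two squares *)

Lemma dvdz_gcd_mul (s a b : int) : (s %| a * b)%Z ->
  (s %| gcdz s a * gcdz s b)%Z.
Proof.
rewrite !dvdzE !abszM /gcdz /= => h.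
rewrite muln_gcdl dvdn_gcd dvdn_mulr //=.
by rewrite muln_gcdr dvdn_gcd h dvdn_mull.
Qed.

Section TwoSquares.
Variables (R : realType) (s : nat).
Hypothesis s_gt0 : (0 < s)%N.

Lemma coprime_sumsq (x y : int) : x ^+ 2 + y ^+ 2 = s -> coprimez x y ->
  coprimez s x.
Proof.
move=> <- cxy.
rewrite /coprimez gcdzC [x ^+ 2]expr2 gcdzMDl.
by rewrite -/(coprimez _ _) coprimezXr.
Qed.

(* The determinant and the dot product with a fixed vector determine a vector. *)
Lemma atmost_sumsq_det (p : int * int) (D : int) :
  p.1 ^+ 2 + p.2 ^+ 2 = s ->
  @atmost R _ [set q : int * int | q.1 ^+ 2 + q.2 ^+ 2 = s
     /\ p.1 * q.2 - q.1 * p.2 = D] 2.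
Proof.
case: p => a b /= ps.
have -> : 2 = 2 * (1 + 0) :> R by rewrite addr0 mulr1.
(* By Lagrange's identity the square of the dot product is [s ^ 2 - D ^ 2], which leaves at most two
   opposite values. *)
apply: (@atmost_inj _ _ _ (fun q => a * q.1 + b * q.2) _
   [set z : int | z ^+ 2 = s%:Z ^+ 2 - D ^+ 2]).
- move=> [x y] /= [qs <-].
  have -> : s%:Z ^+ 2 = (a ^+ 2 + b ^+ 2) * (x ^+ 2 + y ^+ 2) by rewrite ps qs.
  ring.
- move=> [x y] [x' y'] /= [_ d] [_ d'] e.
  have s0 : s%:Z != 0 by lia.
  have sx u v : s%:Z * u = a * (a * u + b * v) - b * (a * v - u * b).
    by rewrite -ps; ring.
  have sy u v : s%:Z * v = b * (a * u + b * v) + a * (a * v - u * b).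
    by rewrite -ps; ring.
  by congr pair; apply: (mulfI s0); rewrite ?(sx x y) ?(sx x' y') ?(sy x y)
    ?(sy x' y') e d d'.
apply: atmost_int_abs => // x y /= hx hy.
have : `|x| = `|y| :> int.
  by apply/eqP; rewrite -(eqrXn2 (n := 2)) ?normr_ge0 // -!normrX hx hy.
by move=> ->; rewrite subrr normr0.
Qed.

(* [s] divides the product of [x0 * y - x * y0] and [x0 * y + x * y0], so up to
   a factor 2 it is the lcm of its gcds with them; two primitive vectors with
   the same gcds have a determinant divisible by this lcm, hence equal to
   one of at most five numbers. *)
Lemma atmost_primitive_sumsq :
  @atmost R _ [set q : int * int | q.1 ^+ 2 + q.2 ^+ 2 = s /\ coprimez q.1 q.2]
    ((size (divisors s))%:R ^+ 2 * 10).
Proof.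
apply: atmost_pick => [|[x0 y0] /= [ps0 cp0]].
  by rewrite mulr_ge0 // exprn_ge0.
pose A (q : int * int) := x0 * q.2 - q.1 * y0.
pose B (q : int * int) := x0 * q.2 + q.1 * y0.
pose f q := (absz (gcdz s (A q)), absz (gcdz s (B q))).
have s0 : s%:Z != 0 by lia.
have cs0 := coprime_sumsq ps0 cp0.
apply: (@atmost_fiber _ _ _ f _ [set g | g.1 \in divisors s /\ g.2 \in divisors s]) => //.
- move=> q _; rewrite /= -!dvdn_divisors //.
  by split; [exact: (dvdz_gcdl s (A q)) | exact: (dvdz_gcdl s (B q))].
- rewrite expr2 -natrM -(size_allpairs pair).
  by apply: (atmost_seq (s := [seq (x, y) | x <- divisors s, y <- divisors s]))
    => -[g h] [/= gs hs]; apply/allpairsP; exists (g, h).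
move=> [g h] _.
apply: atmost_pick => // -[x1 y1] /= [[ps1 cp1] [eg eh]].
have dg q : f q = (g, h) -> (g %| A q)%Z /\ (h %| B q)%Z.
  by case=> <- <-; split;
    [exact: (dvdz_gcdr s (A q)) | exact: (dvdz_gcdr s (B q))].
have gs : (g %| s)%N by rewrite -eg; exact: (dvdz_gcdl s (A (x1, y1))).
have hs : (h %| s)%N by rewrite -eh; exact: (dvdz_gcdl s (B (x1, y1))).
have sgh : (s %| g * h)%N.
  have : (s%:Z %| gcdz s (A (x1, y1)) * gcdz s (B (x1, y1)))%Z.
    (* Both vectors have squared norm [s], so [A * B] at [(x1, y1)] equals
       [s * (x0 ^ 2 - x1 ^ 2)]. *)
    apply: dvdz_gcd_mul; apply/dvdzP; exists (x0 ^+ 2 - x1 ^+ 2).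
    have -> : (x0 ^+ 2 - x1 ^+ 2) * s%:Z
        = x0 ^+ 2 * (x1 ^+ 2 + y1 ^+ 2) - x1 ^+ 2 * (x0 ^+ 2 + y0 ^+ 2).
      by rewrite ps1 ps0 mulrBl.
    by rewrite /A /B /=; ring.
  by rewrite dvdzE abszM /= eg eh.
have cps q : q.1 ^+ 2 + q.2 ^+ 2 = s%:Z -> coprimez q.1 q.2 -> coprimez s q.2.
  by move=> e c; apply: (@coprime_sumsq q.2 q.1); rewrite ?[coprimez q.2 _]coprimez_sym // addrC.
have cx0 m : (m %| s)%N -> coprimez m x0.
  move=> ms; rewrite coprimezE; apply: coprime_dvdl ms _; exact: cs0.
(* [A + B] is [2 * x0 * y1], and both [x0] and [y1] are prime to [s]. *)
have gcd2 : (gcdn g h %| 2)%N.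
  have ks : (gcdn g h %| s)%N by apply: dvdn_trans gs; exact: dvdn_gcdl.
  have [dA dB] := dg (x1, y1) (f_equal2 pair eg eh).
  have : (gcdn g h %| x0 * (y1 * 2))%Z.
    have -> : x0 * (y1 * 2) = A (x1, y1) + B (x1, y1) by rewrite /A /B /=; ring.
    by apply: rpredD; [apply: dvdz_trans dA|apply: dvdz_trans dB];
      rewrite dvdzE /= ?dvdn_gcdl ?dvdn_gcdr.
  rewrite Gauss_dvdzr ?cx0 // Gauss_dvdzr //.
  rewrite coprimezE; apply: coprime_dvdl ks _; exact: (cps (x1, y1)).
pose l := lcmn g h.
have g0 := dvdn_gt0 s_gt0 gs; have h0 := dvdn_gt0 s_gt0 hs.
have ls : (s <= 2 * l)%N.
  have gh0 : (0 < g * h)%N by rewrite muln_gt0 g0.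
  apply: leq_trans (dvdn_leq gh0 sgh) _.
  by rewrite -muln_lcm_gcd mulnC leq_mul2r dvdn_leq ?orbT.
have l0 : (0 < l)%N by rewrite lcmn_gt0 g0.
pose det (q : int * int) := x1 * q.2 - q.1 * y1.
have -> : 10 = 5 * 2 :> R by rewrite -natrM.
apply: (@atmost_fiber _ _ _ det _ [set z : int | (l %| z)%Z /\ (absz z <= s)%N]) => //.
- move=> [x2 y2] [[/= ps2 cp2] ef]; split.
    have [dA1 dB1] := dg (x1, y1) (f_equal2 pair eg eh).
    have [dA2 dB2] := dg _ ef.
    (* [x0] is prime to [g], and [x0 * det] is a combination of two values of [A] that [g] divides;
       the same works for [h] and [B]. *)
    have gd : (g %| det (x2, y2))%Z.
      rewrite -(Gauss_dvdzr _ (cx0 _ gs)).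
      have -> : x0 * det (x2, y2) = x1 * A (x2, y2) - x2 * A (x1, y1).
        by rewrite /A /det /=; ring.
      by apply: rpredB; exact: dvdz_mull.
    have hd : (h %| det (x2, y2))%Z.
      rewrite -(Gauss_dvdzr _ (cx0 _ hs)).
      have -> : x0 * det (x2, y2) = x1 * B (x2, y2) - x2 * B (x1, y1).
        by rewrite /B /det /=; ring.
      by apply: rpredB; exact: dvdz_mull.
    by move: gd hd; rewrite !dvdzE /= dvdn_lcm => -> ->.
  (* Lagrange's identity again: the difference of the two sides is the square of the dot product. *)
  have : det (x2, y2) ^+ 2 <= s%:Z ^+ 2.
    have -> : s%:Z ^+ 2 = (x1 ^+ 2 + y1 ^+ 2) * (x2 ^+ 2 + y2 ^+ 2).
      by rewrite ps1 ps2.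
    rewrite -subr_ge0 /det /=.
    have -> : (x1 ^+ 2 + y1 ^+ 2) * (x2 ^+ 2 + y2 ^+ 2) - (x1 * y2 - x2 * y1) ^+ 2
      = (x1 * x2 + y1 * y2) ^+ 2 by ring.
    exact: sqr_ge0.
  by rewrite -(real_normK (num_real (det _))) ler_pXn2r ?nnegrE //; lia.
(* A multiple of [l] of size at most [s <= 2 * l] has its quotient between [-2] and [2]. *)
- have -> : 5 = 1 + 4 :> R by rewrite -[RHS](natrD _ 1 4).
  apply: (@atmost_inj _ _ _ (fun z => (z %/ l)%Z) _ [set z : int | (absz z <= 2)%N]).
  + move=> z /= [/dvdzP[q ->] hq]; rewrite mulzK; last by lia.
    by move: hq; rewrite abszM /= => /leq_trans/(_ ls); rewrite leq_pmul2r.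
  + by move=> x y [/divzK xl _] [/divzK yl _] e; rewrite -xl -yl e.
  apply: atmost_int => // x y /= hx hy.
  have -> : 4 = (4%:Z)%:~R :> R by [].
  by rewrite ler_int; clear -hx hy; lia.
move=> D _; apply: (atmost_le (@atmost_sumsq_det (x1, y1) D ps1)) => //.
by move=> [x2 y2] [[[e _] _] <-].
Qed.

End TwoSquares.

(** Dividing by the gcd [g] of the coordinates leaves a primitive representation of [s / g ^ 2]. The
    choice of [g] among the divisors of [s] adds one factor to the square of the primitive case. *)
Lemma atmost_sumsq (R : realType) (s : nat) : (0 < s)%N ->
  @atmost R _ [set q : int * int | q.1 ^+ 2 + q.2 ^+ 2 = s]
    (10 * (size (divisors s))%:R ^+ 3).
Proof.
move=> s0.
set d := (size (divisors s))%:R : R.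
have -> : 10 * d ^+ 3 = d * (d ^+ 2 * 10) by ring.
apply: (@atmost_fiber _ _ _ (fun q => gcdn (absz q.1) (absz q.2)) _
  [set g | g \in divisors s]).
- by rewrite mulr_ge0 // exprn_ge0.
- move=> [x y] /= e; rewrite -dvdn_divisors //.
  suff : ((gcdn `|x| `|y|)%:Z %| s%:Z)%Z by [].
  by rewrite -e !expr2; apply: rpredD; apply: dvdz_mulr; rewrite dvdzE /=
    ?dvdn_gcdl ?dvdn_gcdr.
- exact: atmost_seq.
move=> g; rewrite /= -dvdn_divisors // => gs.
have g0 := dvdn_gt0 s0 gs.
apply: atmost_pick; first by rewrite mulr_ge0 // exprn_ge0.
have red q : q.1 ^+ 2 + q.2 ^+ 2 = s%:Z /\ gcdn `|q.1| `|q.2| = g ->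
  exists u v : int, [/\ q = (u * g, v * g), coprimez u v
    & (u ^+ 2 + v ^+ 2) * (g ^ 2)%N = s%:Z].
  case: q => x y /= [e eg].
  have /dvdzP[u xu] : (g %| x)%Z by rewrite dvdzE -eg dvdn_gcdl.
  have /dvdzP[v yv] : (g %| y)%Z by rewrite dvdzE -eg dvdn_gcdr.
  exists u, v; split; first by rewrite xu yv.
    move: eg; rewrite xu yv !abszM /= -muln_gcdl => /eqP.
    by rewrite -{2}[g]mul1n eqn_pmul2r // coprimezE.
  by rewrite -e xu yv PoszM; ring.
move=> q0 /= /red[u0 [v0 [_ _ e0]]].
have g2s : (g ^ 2 %| s)%N.
  by suff : ((g ^ 2)%N%:Z %| s%:Z)%Z by []; rewrite -e0; apply: dvdz_mull.
have s'0 : (0 < s %/ g ^ 2)%N by rewrite divn_gt0 ?expn_gt0 ?g0 // dvdn_leq.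
have eqs (u v : int) : (u ^+ 2 + v ^+ 2) * (g ^ 2)%N = s%:Z ->
    u ^+ 2 + v ^+ 2 = (s %/ g ^ 2)%N%:Z.
  rewrite -{1}(divnK g2s) PoszM; apply: mulIf.
  by rewrite -lt0n expn_gt0 g0.
apply: (@atmost_inj _ _ _ (fun q => ((q.1 %/ g)%Z, (q.2 %/ g)%Z)) _
  [set q : int * int | q.1 ^+ 2 + q.2 ^+ 2 = (s %/ g ^ 2)%N /\ coprimez q.1 q.2]).
- move=> q /red[u [v [-> cuv e]]] /=.
  by rewrite !mulzK; [split => //; exact: eqs | lia..].
- move=> q q' /red[u [v [-> _ _]]] /red[u' [v' [-> _ _]]] /=.
  by rewrite !mulzK; [case=> -> -> | lia..].
apply: (atmost_le (atmost_primitive_sumsq R s'0)) => //.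
rewrite ler_wpM2r // lerXn2r ?nnegrE // ler_nat.
by apply: size_divisors_dvd => //; exact: dvdn_div.
Qed.

(** The divisor bound with exponent [3 * (2 * b)] makes the cube of the number of divisors
    [O(s ^ (1 / (2 * b)))], hence [O(z)]. *)
Lemma atmost_sumsq_uniform (R : realType) (b : nat) (L : R) :
  (0 < b)%N -> 0 <= L ->
  exists2 K : R, 0 < K & forall (z : R) (s : nat), 1 <= z ->
    s%:R <= L * z ^+ (2 * b) ->
    atmost [set q : int * int | q.1 ^+ 2 + q.2 ^+ 2 = s] (K * z).
Proof.
move=> b0 L0.
have [|c c0 hc] := @divisor_bound (3 * (2 * b)); first by rewrite muln_gt0 muln_gt0 b0.
have K1 : 1 <= c%:R * L + 1 by rewrite lerDr mulr_ge0.
exists (10 * (c%:R * L + 1)) => [|z s z1 sz].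
  by rewrite mulr_gt0 // (lt_le_trans _ K1).
have z0 : 0 <= z by exact: le_trans z1.
(* The divisor bound excludes zero, whose only representation is [(0, 0)]. *)
have [->|s0] := posnP s.
  apply: (@atmost_le _ _ _ _ [set (0, 0)] 1).
  - by apply: (atmost_seq (s := [:: (0, 0)])) => x ->; rewrite mem_head.
  - by move=> [x y] /= e; congr pair; nia.
  by nra.
apply: (atmost_le (atmost_sumsq R s0)) => //.
rewrite -mulrA ler_wpM2l //.
rewrite -(@ler_pXn2r _ (2 * b)) ?nnegrE ?muln_gt0 ?b0 ?exprn_ge0 //; last first.
  by rewrite mulr_ge0 // (le_trans _ K1).
rewrite -exprM -natrX (le_trans (y := (c * s)%:R)) //.
  by rewrite ler_nat hc.
rewrite natrM exprMn.
apply: (@le_trans _ _ (c%:R * L * z ^+ (2 * b))).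
  by rewrite -mulrA ler_wpM2l.
rewrite ler_wpM2r ?exprn_ge0 //.
apply: (@le_trans _ _ (c%:R * L + 1)); first by rewrite lerDl.
by rewrite -[leLHS]expr1 ler_weXn2l // muln_gt0 b0.
Qed.

(** * Lattice points in boxes, spheres and shells *)

Section Boxes.
Variables (R : realType) (I : finType).
Implicit Types (k : {ffun I -> int}) (D : {set I}).

Definition sqnorm k : int := \sum_i k i ^+ 2.

(** Erasing coordinates, rather than changing the index type, keeps partial vectors in one type;
    [restrict D k = k] says that [k] is supported on [D]. *)
Definition restrict D k : {ffun I -> int} := [ffun i => if i \in D then k i else 0].

Definition box (N : R) k := forall i, `|k i|%:~R <= N.

Lemma box_restrict D (N : R) k : 0 <= N -> box N k -> box N (restrict D k).
Proof. by move=> N0 bk i; rewrite ffunE; case: ifP => // _; rewrite normr0. Qed.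

Lemma restrict_id D k : restrict D (restrict D k) = restrict D k.
Proof. by apply/ffunP => i; rewrite !ffunE; case: ifP => // ->. Qed.

Lemma atmost_box_on D (N : R) : 0 <= N ->
  atmost [set k | box N k /\ restrict D k = k] ((1 + 2 * N) ^+ #|D|).
Proof.
move=> N0; have [d hD] := ubnP #|D|; elim: d D hD => // d IH D hD.
have [D0|[j jD]] := set_0Vmem D.
  rewrite D0 cards0 expr0.
  apply: (atmost_seq (s := [:: [ffun=> 0] : {ffun I -> int}])) => k [_ kD].
  by rewrite inE; apply/eqP/ffunP => i; rewrite -kD !ffunE inE.
have cD : #|D| = #|D :\ j|.+1 by rewrite (cardsD1 j) jD.
rewrite cD exprSr.
apply: (@atmost_fiber _ _ _ (restrict (D :\ j)) _
  [set k | box N k /\ restrict (D :\ j) k = k]).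
- by rewrite addr_ge0 // mulr_ge0.
- by move=> k [bk _]; split; [exact: box_restrict | exact: restrict_id].
- by apply: IH; rewrite -ltnS -cD.
move=> u _; apply: (@atmost_inj _ _ _ (fun k => k j) _
  [set z : int | `|z|%:~R <= N]).
- by move=> k [[bk _] _]; exact: bk.
- move=> k k' [[_ kD] ku] [[_ k'D] k'u] e; apply/ffunP => i.
  have [->//|ij] := eqVneq i j.
  have := congr1 (fun f : {ffun I -> int} => f i) (etrans ku (esym k'u)).
  rewrite !ffunE !inE ij /=; case: ifP => // iD _.
  by rewrite -kD -k'D !ffunE iD.
exact: atmost_int_ball.
Qed.

Lemma atmost_box (N : R) : 0 <= N -> atmost [set k | box N k] ((1 + 2 * N) ^+ #|I|).
Proof.
move=> N0; have := @atmost_box_on [set: I]%SET N N0; rewrite cardsT => h.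
apply: (atmost_le h) => // k bk.
by split => //; apply/ffunP => i; rewrite ffunE inE.
Qed.

Lemma restrict_eq D k k' i : restrict D k = restrict D k' -> i \in D -> k i = k' i.
Proof.
by move/(congr1 (fun f : {ffun I -> int} => f i)); rewrite !ffunE => + iD; rewrite iD.
Qed.

Lemma sqnormD1 k j : sqnorm k = k j ^+ 2 + \sum_(i | i != j) k i ^+ 2.
Proof. by rewrite /sqnorm (bigD1 j). Qed.

(** Once the coordinates other than [a] and [b] are chosen in the box, the squares of these two add
    up to a fixed number not exceeding [s]. *)
Lemma atmost_sphere (a b : I) (N r : R) (s : nat) : 0 <= N -> 0 <= r -> a != b ->
  (forall s', (s' <= s)%N ->
     atmost [set q : int * int | q.1 ^+ 2 + q.2 ^+ 2 = s'] r) ->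
  atmost [set k | box N k /\ sqnorm k = s] ((1 + 2 * N) ^+ (#|I| - 2) * r).
Proof.
move=> N0 r0 ab hr.
have cD : #|~: [set a; b]| = (#|I| - 2)%N by rewrite cardsCs finset.setCK cards2 ab.
rewrite -cD; apply: (@atmost_fiber _ _ _ (restrict (~: [set a; b])) _
  [set k | box N k /\ restrict (~: [set a; b]) k = k]) => //; last 2 first.
- exact: atmost_box_on.
- move=> u _; apply: atmost_pick => // k0 [[_ ks0] ku0].
  pose rest k : int := \sum_(i | (i != a) && (i != b)) k i ^+ 2.
  have split2 k : sqnorm k = k a ^+ 2 + k b ^+ 2 + rest k.
    rewrite /sqnorm (bigD1 a) //= (bigD1 b) ?(eq_sym b) //= addrA.
    by congr (_ + _); apply: eq_bigl => i.
  have restk k : restrict (~: [set a; b]) k = u -> rest k = rest k0.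
    move=> ku; apply: eq_bigr => i /andP[ia ib].
    by rewrite (restrict_eq (etrans ku (esym ku0))) // !inE negb_or ia.
  have rest0 : 0 <= rest k0 by apply: sumr_ge0 => i _; exact: sqr_ge0.
  have es : (k0 a ^+ 2 + k0 b ^+ 2) + rest k0 = s%:Z by rewrite -split2.
  have pos : 0 <= k0 a ^+ 2 + k0 b ^+ 2 by rewrite addr_ge0 ?sqr_ge0.
  apply: (@atmost_inj _ _ _ (fun k => (k a, k b)) _ _ _ _ _
    (hr (absz (k0 a ^+ 2 + k0 b ^+ 2)) _)).
  + move=> k [[_ ks] ku] /=; rewrite gez0_abs //.
    by apply: (addIr (rest k0)); rewrite es -ks split2 restk.
  + move=> k k' [_ ku] [_ k'u] [ea eb]; apply/ffunP => i.
    have [->//|ia] := eqVneq i a; have [->//|ib] := eqVneq i b.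
    by rewrite (restrict_eq (etrans ku (esym k'u))) // !inE negb_or ia.
  + by move: es rest0 pos; move: (_ + _) (rest k0) => x y; clear; lia.
- by move=> k [bk _]; split; [exact: box_restrict | exact: restrict_id].
Qed.

(* Some coordinate of a vector of the shell has size at least of order [Q], so
   it is confined to an interval of length [O (E / Q)] by the other ones. *)
Lemma atmost_shell (K : R) : 1 <= K -> exists2 K' : R, 0 < K' &
  forall Q E : R, 1 <= Q -> Q <= E ->
  atmost [set k | box (K * Q) k /\ `|(sqnorm k)%:~R - Q ^+ 2| <= E]
    (K' * Q ^+ #|I| * (E / Q ^+ 2)).
Proof.
move=> K1.
pose d := #|I|; pose G : R := (3 * K) ^+ d.
have K0 : 0 <= K by exact: le_trans K1.
have G1 : 1 <= G by rewrite exprn_ege1 //; lra.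
have G0 : 0 < G by exact: lt_le_trans G1.
exists (2 * G + d%:R * (G * (2 * (1 + 2 * d.+1%:R)))) => [|Q E Q1 QE].
  by rewrite ltr_pwDl ?mulr_gt0 // !mulr_ge0 ?addr_ge0 ?mulr_ge0 // ltW.
have Q0 : 0 < Q by exact: lt_le_trans Q1.
have E0 : 0 < E by exact: lt_le_trans QE.
have Gge := ltW G0; have Qge := ltW Q0; have Ege := ltW E0.
have N0 : 0 <= K * Q by rewrite mulr_ge0 // ltW.
have side : 1 + 2 * (K * Q) <= 3 * K * Q by nra.
have side0 : 0 <= 1 + 2 * (K * Q) by rewrite addr_ge0 // mulr_ge0.
have boxle e : (1 + 2 * (K * Q)) ^+ e <= (3 * K * Q) ^+ e.
  by rewrite lerXn2r // nnegrE (le_trans side0).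
have EQ0 : 0 <= Q ^+ d * (E / Q ^+ 2).
  by rewrite mulr_ge0 ?divr_ge0 ?exprn_ge0 // ltW.
(* A shell this thick may be replaced by the whole box, as [E / Q ^ 2] is at least [1 / 2]. *)
have [bigE|smallE] := leP (Q ^+ 2 / 2) E.
  apply: (atmost_le (atmost_box N0)) => [k []//|].
  apply: (le_trans (boxle _)); rewrite exprMn -/G -/d.
  apply: (@le_trans _ _ (2 * G * (Q ^+ d * (E / Q ^+ 2)))); last first.
    rewrite -[leRHS]mulrA ler_wpM2r // lerDl.
    by do 3 (apply: mulr_ge0 => //); rewrite addr_ge0 // mulr_ge0.
  have -> : 2 * G * (Q ^+ d * (E / Q ^+ 2)) = G * Q ^+ d * (2 * (E / Q ^+ 2)) by ring.
  have E1 : 1 <= 2 * (E / Q ^+ 2) by rewrite mulrA ler_pdivlMr ?exprn_gt0 //; lra.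
  by rewrite ler_peMr //; apply: mulr_ge0 => //; exact: exprn_ge0.
(* If all coordinates were below this [h], the squared norm would be at most [Q ^ 2 / 4], whereas in
   the thin shell it exceeds [Q ^ 2 / 2]. *)
pose h : R := Q / (2 * d.+1%:R).
have h0 : 0 < h by rewrite divr_gt0 // mulr_gt0.
have big k : `|(sqnorm k)%:~R - Q ^+ 2| <= E -> exists j, h <= `|k j|%:~R.
  move=> hk; apply: contrapT => /forallNP hj.
  have : (sqnorm k)%:~R <= d%:R * h ^+ 2.
    rewrite /sqnorm rmorph_sum /= mulr_natl -[d]/(#|I|) -sumr_const.
    apply: ler_sum => i _; have /negP := hj i; rewrite -ltNge => /ltW hi.
    by rewrite -(real_normK (num_real (k i))) rmorphXn /= lerXn2r // nnegrE ?ler0z // ltW.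
  have hQ : h * (2 * (d%:R + 1)) = Q by rewrite natr1 mulfVK // mulf_neq0.
  have dR : 0 <= d%:R :> R by [].
  have hd : h * d%:R <= Q / 2 by lra.
  have h2 : h <= Q / 2 by rewrite ler_pdivlMr //; nra.
  move: hk; rewrite ler_norml => /andP[hk _].
  nra.
pose F j := [set k | [/\ box (K * Q) k, `|(sqnorm k)%:~R - Q ^+ 2| <= E
  & h <= `|k j|%:~R]].
pose r := G * (2 * (1 + 2 * d.+1%:R)) * (Q ^+ d * (E / Q ^+ 2)).
have F_le j : j \in enum I -> atmost (F j) r.
  move=> _; have d1 : (0 < d)%N by apply/card_gt0P; exists j.
  (* With the other coordinates fixed, the squares of two values of [k j] differ by at most [2 * E],
     and their absolute values add up to at least [2 * h]. *)
  pose L := 2 * E / (2 * h).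
  have L0 : 0 <= L by rewrite divr_ge0 ?mulr_ge0 // ltW.
  have cD : #|~: [set j]| = d.-1 by rewrite cardsC1.
  apply: (@atmost_le _ _ _ _ (F j) ((1 + 2 * (K * Q)) ^+ d.-1 * (2 * (1 + L)))) => //.
    rewrite -cD; apply: (@atmost_fiber _ _ _ (restrict (~: [set j])) _
      [set k | box (K * Q) k /\ restrict (~: [set j]) k = k]).
    - by rewrite mulr_ge0 // addr_ge0.
    - by move=> k [bk _]; split; [exact: box_restrict | exact: restrict_id].
    - exact: atmost_box_on.
    move=> u _; apply: (@atmost_inj _ _ _ (fun k => k j) _
      [set z : int | exists k, [/\ z = k j, F j k & restrict (~: [set j]) k = u]]).
    - by move=> k [Fk ku]; exists k.
    - move=> k k' [_ ku] [_ k'u] e; apply/ffunP => i.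
      have [->//|ij] := eqVneq i j.
      by rewrite (restrict_eq (etrans ku (esym k'u))) // !inE.
    apply: atmost_int_abs => // x y [k [-> [_ sk hk] ku]] [k' [-> [_ sk' hk'] k'u]].
    rewrite ler_pdivlMr ?mulr_gt0 //.
    have : sqnorm k - sqnorm k' = k j ^+ 2 - k' j ^+ 2.
      rewrite !(sqnormD1 _ j) opprD addrACA.
      rewrite (eq_bigr (fun i => k' i ^+ 2)) ?subrr ?addr0 // => i ij.
      by rewrite (restrict_eq (etrans ku (esym k'u))) // !inE.
    move/(congr1 (fun z : int => z%:~R : R)); rewrite !rmorphB /=.
    rewrite -(real_normK (num_real (k j))) -(real_normK (num_real (k' j))) !rmorphXn /=.
    move: sk sk' hk hk'; move: (`|k j|%:~R) (`|k' j|%:~R) => x1 y1.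
    move: (_%:~R) (_%:~R) => s1 s2; clear -h0.
    rewrite !ler_norml => /andP[a1 a2] /andP[b1 b2] hx hy e.
    apply: (@le_trans _ _ (`|x1 - y1| * (x1 + y1))).
      by rewrite ler_wpM2l //; lra.
    rewrite -[x1 + y1]ger0_norm; last lra.
    by rewrite -normrM -subr_sqr -e ler_norml; lra.
  (* Thanks to [Q <= E], the [1] in [1 + L] is absorbed by a multiple of [E / Q]. *)
  have EQ1 : 1 <= E / Q by rewrite ler_pdivlMr // mul1r.
  have -> : r = (G * Q ^+ d.-1) * (2 * (1 + 2 * d.+1%:R) * (E / Q)).
    rewrite /r -[X in Q ^+ X](prednK d1) exprS; field; exact: lt0r_neq0.
  have p1 : (1 + 2 * (K * Q)) ^+ d.-1 <= G * Q ^+ d.-1.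
    apply: (le_trans (boxle _)); rewrite exprMn; apply: ler_wpM2r.
      exact: exprn_ge0.
    by apply: ler_weXn2l; [lra | exact: leq_pred].
  have p2 : 2 * (1 + L) <= 2 * (1 + 2 * d.+1%:R) * (E / Q).
    rewrite -mulrA ler_pM2l // mulrDl mul1r lerD //.
    rewrite /L /h; move: (d.+1%:R) (ltr0Sn R d) => D D0.
    rewrite le_eqVlt; apply/orP; left; apply/eqP; field.
    by rewrite !lt0r_neq0.
  apply: ler_pM p1 p2; first exact: exprn_ge0.
  by rewrite mulr_ge0 // addr_ge0.
apply: (atmost_le (atmost_bigU F_le)).
- by move=> k [bk sk]; have [j hj] := big k sk; exists j; rewrite ?mem_enum.
rewrite big_const_seq count_predT -cardE -/d iter_addr_0 -[_ *+ _]mulr_natl.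
by rewrite /r mulrA -[leRHS]mulrA ler_wpM2r // lerDr mulr_ge0.
Qed.
End Boxes.

(** * Lattice points near the gauge sphere *)

(** The cofactor of [x - y] in the difference of powers has nonnegative terms, one of which is
    [y ^ e]. A lower bound on [y] thus turns close powers into close numbers. *)
Lemma ler_normB_exprn (R : realDomainType) (e : nat) (x y : R) :
  0 <= x -> 0 <= y -> `|x - y| * y ^+ e <= `|x ^+ e.+1 - y ^+ e.+1|.
Proof.
move=> x0 y0; rewrite subrXX normrM ler_wpM2l //.
rewrite big_ord_recr /= subnn expr0 mul1r.
rewrite ger0_norm ?lerDr ?sumr_ge0 // => [i _|]; first by rewrite mulr_ge0 ?exprn_ge0.
by rewrite addr_ge0 ?exprn_ge0 // sumr_ge0 // => i _; rewrite mulr_ge0 ?exprn_ge0.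
Qed.

Section Region.
Variables (R : realType) (I : finType) (e : nat) (A C : R).
Hypotheses (A_gt0 : 0 < A) (C_gt0 : 0 < C).
Let A_ge0 := ltW A_gt0.
Let C_ge0 := ltW C_gt0.
Implicit Types (p : {ffun I -> int} * int) (Q delta : R).

(* The pairs whose gauge is close to [Q], after raising to the power
   [alpha = 2 * e.+1]. *)
Definition region Q delta : set ({ffun I -> int} * int) :=
  [set p | `|(sqnorm p.1)%:~R ^+ e.+1 + C * `|p.2|%:~R ^+ e.+1
             - (Q ^+ 2) ^+ e.+1| <= A * delta * Q * (Q ^+ 2) ^+ e].

(* A point of the region has [|m| <= B Q^2] and [|k| <= K1 Q]; [K2] is the width
   constant of [region_near]. *)
Let B : R := 1 + (1 + A) / C.
Let K1 : R := 1 + A.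
Let K2 : R := C * B ^+ e.+1 + (A + 1).

Lemma sqnorm_ge0 (k : {ffun I -> int}) : 0 <= sqnorm k.
Proof. by apply: sumr_ge0 => i _; exact: sqr_ge0. Qed.

Let B_ge1 : 1 <= B.
Proof. by rewrite lerDl divr_ge0 ?addr_ge0 // ltW. Qed.

Let K1_ge1 : 1 <= K1. Proof. by rewrite lerDl ltW. Qed.

Let CB : K1 <= C * B ^+ e.+1.
Proof.
apply: (@le_trans _ _ (C * B)); last first.
  by rewrite ler_pM2l // -[leLHS]expr1 ler_weXn2l.
have -> : C * B = C + (1 + A) by rewrite /B; field; exact: lt0r_neq0.
by rewrite lerDr ltW.
Qed.

Section Fixed.
Variables (Q delta : R).
Hypotheses (Q_ge1 : 1 <= Q) (delta_bd : 0 < delta < 1).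
Let T := Q ^+ 2.

Let Q_gt0 : 0 < Q. Proof. exact: lt_le_trans Q_ge1. Qed.
Let T_gt0 : 0 < T. Proof. exact: exprn_gt0. Qed.
Let Q_ge0 := ltW Q_gt0.
Let T_ge0 := ltW T_gt0.
Let Tn_ge0 m : 0 <= T ^+ m. Proof. exact: exprn_ge0. Qed.

(** As [delta < 1], the allowed error is smaller than the main term [T ^ (e + 1)] by a factor of
    order [Q]. *)
Lemma region_err : A * delta * Q * T ^+ e <= A * T ^+ e.+1 / Q.
Proof.
have -> : A * T ^+ e.+1 / Q = A * 1 * Q * T ^+ e.
  by rewrite exprS /T; field; exact: lt0r_neq0.
move: delta_bd => /andP[d0 d1].
by rewrite !ler_wpM2r // ler_pM2l // ltW.
Qed.

Lemma region_sqnorm p : region Q delta p -> (sqnorm p.1)%:~R <= K1 * T.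
Proof.
rewrite /region /= -/T ler_norml => /andP[_ h].
have h1 : A * T ^+ e.+1 / Q <= A * T ^+ e.+1.
  by rewrite ler_pdivrMr // ler_peMr // mulr_ge0.
have m0 : 0 <= C * `|p.2|%:~R ^+ e.+1 by rewrite mulr_ge0 // exprn_ge0 // ler0z.
have s0 : 0 <= (sqnorm p.1)%:~R :> R by rewrite ler0z sqnorm_ge0.
rewrite -(@ler_pXn2r _ e.+1) ?nnegrE ?mulr_ge0 ?(le_trans _ K1_ge1) //.
apply: (@le_trans _ _ (K1 * T ^+ e.+1)).
  by rewrite /K1 mulrDl mul1r; have := region_err; lra.
by rewrite [(K1 * T) ^+ _]exprMn ler_wpM2r // -[leLHS]expr1 ler_weXn2l.
Qed.

Lemma region_box p : region Q delta p -> box (K1 * Q) p.1.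
Proof.
move=> /region_sqnorm h i.
have K10 : 0 <= K1 by exact: le_trans K1_ge1.
rewrite -(@ler_pXn2r _ 2) ?nnegrE ?ler0z ?mulr_ge0 //.
rewrite -rmorphXn /= real_normK ?num_real //.
apply: (@le_trans _ _ (K1 * T)).
  apply: le_trans h; rewrite ler_int (sqnormD1 _ i) lerDl.
  by apply: sumr_ge0 => j _; exact: sqr_ge0.
by rewrite [(K1 * Q) ^+ _]exprMn ler_wpM2r // -[leLHS]expr1 ler_weXn2l.
Qed.

Lemma region_height p : region Q delta p -> `|p.2|%:~R <= B * T.
Proof.
rewrite /region /= -/T ler_norml => /andP[_ h].
have h1 : A * T ^+ e.+1 / Q <= A * T ^+ e.+1.
  by rewrite ler_pdivrMr // ler_peMr // mulr_ge0.
have s0 : 0 <= (sqnorm p.1)%:~R ^+ e.+1 :> R by rewrite exprn_ge0 // ler0z sqnorm_ge0.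
have B0 : 0 <= B by exact: le_trans B_ge1.
rewrite -(@ler_pXn2r _ e.+1) ?nnegrE ?ler0z ?mulr_ge0 //.
rewrite -(ler_pM2l C_gt0) [(B * T) ^+ _]exprMn mulrA.
apply: (@le_trans _ _ (K1 * T ^+ e.+1)).
  by rewrite /K1 mulrDl mul1r; have := region_err; lra.
by rewrite ler_wpM2r.
Qed.

(** The vertical term and the error are both [O(T ^ (e + 1) * t)]; dividing by [T ^ e] through
    [ler_normB_exprn] confines the squared norm to a shell around [T]. *)
Lemma region_near p (t : R) : region Q delta p -> Q^-1 <= t ->
  `|p.2|%:~R ^+ e.+1 <= (B * T) ^+ e.+1 * t ->
  `|(sqnorm p.1)%:~R - T| <= K2 * T * t.
Proof.
rewrite /region /= -/T => h Qt ht.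
have Te0 : 0 < T ^+ e by exact: exprn_gt0.
rewrite -(ler_pM2r Te0).
apply: le_trans (ler_normB_exprn e _ (ltW T_gt0)) _; first by rewrite ler0z sqnorm_ge0.
have m0 : 0 <= C * `|p.2|%:~R ^+ e.+1 by rewrite mulr_ge0 // exprn_ge0 // ler0z.
have mt : C * `|p.2|%:~R ^+ e.+1 <= C * ((B * T) ^+ e.+1 * t) by rewrite ler_pM2l.
have err : A * T ^+ e.+1 / Q <= A * T ^+ e.+1 * t.
  by rewrite ler_wpM2l // mulr_ge0.
have tT : 0 <= T ^+ e.+1 * t.
  by rewrite mulr_ge0 // (le_trans _ Qt) // invr_ge0.
have -> : K2 * T * t * T ^+ e
    = C * ((B * T) ^+ e.+1 * t) + A * T ^+ e.+1 * t + T ^+ e.+1 * t.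
  by rewrite /K2 [(B * T) ^+ _]exprMn !exprS; ring.
move: h; have := region_err; rewrite !ler_norml => er /andP[h1 h2].
apply/andP; split; lra.
Qed.

End Fixed.
Let K2_ge1 : 1 <= K2.
Proof. by have := CB; rewrite /K2 /K1; have := A_ge0; lra. Qed.

(** With [d] the number of coordinates, the shell holds [O(Q ^ d / w ^ (e + 1))] vectors, each with
    [O(1 + delta * Q * w ^ e)] heights. The product keeps a factor [1 / w], summable over powers of
    two. *)
Lemma atmost_region_dyadic : exists2 K : R, 0 < K &
  forall Q delta w : R, 1 <= Q -> 0 < delta < 1 -> 1 <= w -> w ^+ e.+1 <= Q ->
  atmost [set p | [/\ region Q delta p, B * Q ^+ 2 < `|p.2|%:~R * (2 * w)
                    & `|p.2|%:~R * w <= B * Q ^+ 2]]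
    (K * Q ^+ #|I| * (1 + delta * Q) / w).
Proof.
have [Ks Ks0 shell] := atmost_shell I K1_ge1.
have B0 : 0 < B by exact: lt_le_trans B_ge1.
have K20 : 0 < K2 by exact: lt_le_trans K2_ge1.
pose K3 : R := 2 * A / C * (2 / B) ^+ e.
have K30 : 0 <= K3.
  by apply: mulr_ge0; [apply: divr_ge0 => //; exact: mulr_ge0
                      |apply: exprn_ge0; apply: divr_ge0 => //; exact: ltW].
exists (Ks * K2 * (2 * (1 + K3))) => [|Q delta w Q1 dbd w1 wQ].
  by rewrite !mulr_gt0 // ltr_pwDl.
have Q0 : 0 < Q by exact: lt_le_trans Q1.
have w0 : 0 < w by exact: lt_le_trans w1.
have T0 : 0 < Q ^+ 2 by exact: exprn_gt0.
have d0 : 0 <= delta by case/andP: dbd => /ltW.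
have dQ0 : 0 <= delta * Q by rewrite mulr_ge0 // ltW.
pose t := (w ^+ e.+1)^-1.
have we0 : 0 < w ^+ e.+1 by exact: exprn_gt0.
have t0 : 0 < t by rewrite invr_gt0.
have Qt : Q^-1 <= t by rewrite lef_pV2 ?posrE.
(* [w ^ (e + 1) <= Q] makes the shell thick enough for [atmost_shell]. *)
have QE : Q <= K2 * Q ^+ 2 * t.
  apply: (@le_trans _ _ (1 * Q ^+ 2 * Q^-1)); last first.
    by apply: ler_pM => //; rewrite ?invr_ge0 ?mulr_ge0 ?ler_wpM2r // ltW.
  by rewrite mul1r expr2 mulfK // lt0r_neq0.
pose L := K3 * (delta * Q) * w ^+ e.
have L0 : 0 <= L.
  by apply: mulr_ge0; [exact: mulr_ge0 | apply: exprn_ge0; exact: ltW].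
set S := [set p | _].
apply: (@atmost_le _ _ S _ S
  (Ks * Q ^+ #|I| * (K2 * Q ^+ 2 * t / Q ^+ 2) * (2 * (1 + L)))); last 2 first.
- by [].
- have -> : Ks * Q ^+ #|I| * (K2 * Q ^+ 2 * t / Q ^+ 2) * (2 * (1 + L))
      = Ks * K2 * Q ^+ #|I| * 2 * (t * (1 + L)).
    by field; exact: lt0r_neq0.
  have -> : Ks * K2 * (2 * (1 + K3)) * Q ^+ #|I| * (1 + delta * Q) / w
      = Ks * K2 * Q ^+ #|I| * 2 * ((1 + K3) * (1 + delta * Q) / w).
    by field; exact: lt0r_neq0.
  have Qd0 : 0 <= Q ^+ #|I| by apply: exprn_ge0; exact: ltW.
  apply: ler_wpM2l.
    by do ?apply: mulr_ge0 => //; exact: ltW.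
  rewrite ler_pdivlMr // mulrAC.
  have -> : t * w = (w ^+ e)^-1 by rewrite /t exprS; field; rewrite !lt0r_neq0 ?exprn_gt0.
  rewrite mulrC ler_pdivrMr ?exprn_gt0 //.
  have w1e : 1 <= w ^+ e by rewrite exprn_ege1.
  rewrite /L; move: (w ^+ e) w1e => W W1.
  have -> : (1 + K3) * (1 + delta * Q) * W
     = W + K3 * (delta * Q) * W + (K3 + delta * Q) * W by ring.
  have : 0 <= (K3 + delta * Q) * W by rewrite mulr_ge0 ?addr_ge0 //; lra.
  lra.
apply: (@atmost_fiber _ _ _ fst _ _ _ _ _ _ (shell Q _ Q1 QE)).
- by rewrite mulr_ge0 // addr_ge0.
- move=> p [rp _ hp]; split; first exact: (region_box Q1 dbd rp).
  apply: (region_near Q1 dbd rp Qt).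
  rewrite /t ler_pdivlMr // -exprMn lerXn2r // nnegrE mulr_ge0 ?ler0z ?(ltW T0) //.
    exact: ltW.
  exact: ltW.
move=> u _; apply: (@atmost_inj _ _ _ snd _
   [set m | region Q delta (u, m) /\ B * Q ^+ 2 < `|m|%:~R * (2 * w)]).
- by move=> [k m] [[rp hm _] /= <-].
- by move=> [k m] [k' m'] [_ /= ->] [_ /= ->] ->.
apply: atmost_int_abs => // m m' [rm _] [rm' hm'].
set h := B * Q ^+ 2 / (2 * w).
have h0 : 0 < h by rewrite divr_gt0 // mulr_gt0.
have hle : h <= `|m'|%:~R by rewrite ler_pdivrMr ?mulr_gt0 // ltW.
(* Two heights over the same [k] have close powers; the lower bound [h] on [|m'|] turns this into a
   distance of at most [L]. *)
rewrite -(@ler_pM2r _ (h ^+ e)) ?exprn_gt0 //.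
have -> : L * h ^+ e = 2 * (A * delta * Q * (Q ^+ 2) ^+ e) / C.
  have -> : h ^+ e = (B * Q ^+ 2) ^+ e / (2 * w) ^+ e by rewrite expr_div_n.
  rewrite /L /K3 expr_div_n !exprMn.
  by field; rewrite !lt0r_neq0 ?exprn_gt0.
apply: (@le_trans _ _ (`| `|m|%:~R - `|m'|%:~R | * `|m'|%:~R ^+ e)).
  by rewrite ler_wpM2l // lerXn2r // nnegrE ?ler0z // ltW.
apply: (le_trans (ler_normB_exprn e _ _)); rewrite ?ler0z //.
rewrite ler_pdivlMr // -[X in _ * X <= _](gtr0_norm C_gt0) -normrM mulrC mulrBr.
move: rm rm'; rewrite /region /= !ler_norml => /andP[a1 a2] /andP[b1 b2].
apply/andP; split; lra.
Qed.

(** There are [O(Q ^ 2 / z)] heights, [O(1 + delta * Q)] squared norms for each, and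
    [O(Q ^ (d - 2) * z)] vectors on each sphere in [d] coordinates: the two [z] cancel.
    [Q < z ^ (e + 1)] bounds the squared norms by [K1 * z ^ (2 * (e + 1))], as
    [atmost_sumsq_uniform] requires. *)
Lemma atmost_region_low (a b : I) : a != b -> exists2 K : R, 0 < K &
  forall Q delta z : R, 1 <= Q -> 0 < delta < 1 -> 2 <= z ->
  Q < z ^+ e.+1 -> (z / 2) ^+ e.+1 <= Q ->
  atmost [set p | region Q delta p /\ `|p.2|%:~R * z <= B * Q ^+ 2]
    (K * Q ^+ #|I| * (1 + delta * Q)).
Proof.
move=> ab.
have d2 : (2 <= #|I|)%N by have := max_card [set a; b]%SET; rewrite cards2 ab.
have K1_ge0 : 0 <= K1 by exact: le_trans K1_ge1.
have B0 : 0 < B by exact: lt_le_trans B_ge1.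
have K20 : 0 < K2 by exact: lt_le_trans K2_ge1.
have [Kr Kr0 two] := @atmost_sumsq_uniform R e.+1 K1 isT K1_ge0.
pose G : R := (3 * K1) ^+ #|I|.
have G0 : 0 < G by apply: exprn_gt0; have := K1_ge1; lra.
pose Ka : R := G * (1 + 2 * (B * (2 * K2) ^+ 2)).
pose Kb : R := (2 + 2 * B) * (1 + 2 * A * 2 ^+ e) * (G * Kr).
have Ka0 : 0 < Ka.
  apply: mulr_gt0 => //; apply: ltr_pwDl => //; apply: mulr_ge0 => //.
  by apply: mulr_ge0; [exact: ltW | exact: sqr_ge0].
have Kb0 : 0 < Kb.
  apply: mulr_gt0; last exact: mulr_gt0.
  by apply: mulr_gt0; [lra | rewrite ltr_pwDl // !mulr_ge0].
exists (Ka + Kb) => [|Q delta z Q1 dbd z2 Qz zQ]; first exact: addr_gt0.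
have Q0 : 0 < Q by exact: lt_le_trans Q1.
have z0 : 0 < z by exact: lt_le_trans z2.
have T0 : 0 < Q ^+ 2 by exact: exprn_gt0.
have d0 : 0 <= delta by case/andP: dbd => /ltW.
have dQ0 : 0 <= delta * Q by rewrite mulr_ge0 // ltW.
have Qd0 m : 0 <= Q ^+ m by apply: exprn_ge0; exact: ltW.
have N0 : 0 <= K1 * Q by apply: mulr_ge0 => //; exact: ltW.
have side0 : 0 <= 1 + 2 * (K1 * Q) by lra.
have boxle m : (m <= #|I|)%N -> (1 + 2 * (K1 * Q)) ^+ m <= G * Q ^+ m.
  move=> mI; apply: (@le_trans _ _ ((3 * K1) ^+ m * Q ^+ m)).
    rewrite -[leRHS]exprMn; apply: lerXn2r; rewrite ?nnegrE //; first by nra.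
    by have := K1_ge1; nra.
  by apply: ler_wpM2r => //; apply: ler_weXn2l => //; have := K1_ge1; lra.
have P0 : 0 <= Q ^+ #|I| * (1 + delta * Q) by rewrite mulr_ge0 // addr_ge0.
set S := [set p | _].
(* For bounded [Q] there are boundedly many heights, and the box suffices for [k]. *)
have [smallQ|bigQ] := leP Q (2 * K2).
  have H0 : 0 <= B * (2 * K2) ^+ 2 by apply: mulr_ge0; [exact: ltW | exact: sqr_ge0].
  have X0 : 0 <= 1 + 2 * (B * (2 * K2) ^+ 2) by lra.
  apply: (@atmost_le _ _ S _ S ((1 + 2 * (K1 * Q)) ^+ #|I|
                                * (1 + 2 * (B * (2 * K2) ^+ 2)))) => //.
    have hB := @atmost_box R I _ N0.
    apply: (@atmost_fiber _ _ _ fst _ _ _ _ _ _ hB) => //.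
    - by move=> p [rp _]; exact: (region_box Q1 dbd rp).
    move=> u _; apply: (@atmost_inj _ _ _ snd _ _ _ _ _ (atmost_int_ball H0)).
      move=> p [[rp _] _]; apply: (le_trans (region_height Q1 dbd rp)).
      rewrite ler_pM2l //; apply: lerXn2r; rewrite ?nnegrE //; first exact: ltW.
      by lra.
    by move=> [k m] [k' m'] [_ /= ->] [_ /= ->] ->.
  apply: (@le_trans _ _ (Ka * Q ^+ #|I|)).
    by rewrite /Ka [leRHS]mulrAC; apply: ler_wpM2r => //; exact: boxle.
  apply: (@le_trans _ _ (Ka * (Q ^+ #|I| * (1 + delta * Q)))).
    by rewrite ler_pM2l // ler_peMr // lerDl.
  by rewrite -[leRHS]mulrA ler_wpM2r // lerDl ltW.
have Mz0 : 0 <= B * Q ^+ 2 / z.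
  by apply: divr_ge0; [apply: mulr_ge0; exact: ltW | exact: ltW].
have A2e : 0 <= 2 * A * 2 ^+ e by rewrite !mulr_ge0 // exprn_ge0.
have A2Q : 0 <= 2 * A * 2 ^+ e * (delta * Q) by exact: mulr_ge0.
have Krz : 0 <= Kr * z by apply: mulr_ge0; exact: ltW.
have Sph : 0 <= (1 + 2 * (K1 * Q)) ^+ (#|I| - 2) * (Kr * z).
  by apply: mulr_ge0 => //; exact: exprn_ge0.
apply: (@atmost_le _ _ S _ S ((1 + 2 * (B * Q ^+ 2 / z))
   * ((1 + 2 * A * 2 ^+ e * (delta * Q))
   * ((1 + 2 * (K1 * Q)) ^+ (#|I| - 2) * (Kr * z))))); last 2 first.
- by [].
(* This bounds [Q ^ 2 / z] below, so that it absorbs the additive [1] in the number of heights. *)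
- have zQ2 : z <= 2 * Q.
    have : z / 2 <= (z / 2) ^+ e.+1.
      by rewrite -[leLHS]expr1; apply: ler_weXn2l => //; rewrite ler_pdivlMr // mul1r.
    by move/le_trans => /(_ _ zQ); rewrite ler_pdivrMr // mulrC.
  have f1 : 1 + 2 * (B * Q ^+ 2 / z) <= (2 + 2 * B) * (Q ^+ 2 / z).
    have : 1 <= 2 * (Q ^+ 2 / z) by rewrite mulrA ler_pdivlMr // mul1r expr2; nra.
    by rewrite -mulrA; lra.
  have f2 : 1 + 2 * A * 2 ^+ e * (delta * Q)
      <= (1 + 2 * A * 2 ^+ e) * (1 + delta * Q).
    by move: A2e dQ0; move: (2 * A * 2 ^+ e) (delta * Q) => x y x0 y0; nra.
  have f3 : (1 + 2 * (K1 * Q)) ^+ (#|I| - 2) * (Kr * z)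
      <= G * Q ^+ (#|I| - 2) * (Kr * z).
    by apply: ler_wpM2r => //; apply: boxle; exact: leq_subr.
  have f23 := ler_pM (addr_ge0 ler01 A2Q) Sph f2 f3.
  have f123 := ler_pM (addr_ge0 ler01 (mulr_ge0 (ler0n _ 2) Mz0))
    (mulr_ge0 (addr_ge0 ler01 A2Q) Sph) f1 f23.
  apply: (le_trans f123).
  have -> : (2 + 2 * B) * (Q ^+ 2 / z) *
      ((1 + 2 * A * 2 ^+ e) * (1 + delta * Q) * (G * Q ^+ (#|I| - 2) * (Kr * z)))
      = Kb * (Q ^+ 2 * Q ^+ (#|I| - 2) * (1 + delta * Q)).
    by rewrite /Kb; field; exact: lt0r_neq0.
  by rewrite -exprD subnKC // -[leRHS]mulrA ler_wpM2r // lerDr ltW.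
apply: (@atmost_fiber _ _ _ snd S [set m | `|m|%:~R <= B * Q ^+ 2 / z]).
- by apply: mulr_ge0 => //; exact: addr_ge0.
- by move=> p [_ hp] /=; rewrite ler_pdivlMr.
- exact: atmost_int_ball.
move=> m hm.
(* [Q < z ^ (e + 1)] makes [t = 1 / Q] admissible in [region_near], and [Q > 2 * K2] then keeps the
   squared norm above [Q ^ 2 / 2]. *)
have Slow p : S p -> Q ^+ 2 / 2 <= (sqnorm p.1)%:~R.
  move=> [rp hp].
  have : `|(sqnorm p.1)%:~R - Q ^+ 2| <= K2 * Q ^+ 2 * Q^-1.
    apply: (region_near Q1 dbd rp (lexx _)).
    rewrite ler_pdivlMr //.
    apply: (@le_trans _ _ (`|p.2|%:~R ^+ e.+1 * z ^+ e.+1)).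
      by apply: ler_wpM2l; [apply: exprn_ge0; rewrite ler0z | exact: ltW].
    rewrite -exprMn; apply: lerXn2r => //; rewrite nnegrE.
      by apply: mulr_ge0; [rewrite ler0z | exact: ltW].
    by apply: mulr_ge0; exact: ltW.
  have : K2 * Q ^+ 2 * Q^-1 <= Q ^+ 2 / 2.
    by rewrite ler_pdivrMr // expr2; nra.
  by rewrite ler_norml => h /andP[h' _]; lra.
apply: (@atmost_fiber _ _ _ (fun p => sqnorm p.1) _
  [set s | exists p, [/\ S p, p.2 = m & s = sqnorm p.1]]) => //.
- by move=> p [Sp pm]; exists p.
- apply: atmost_int => // x y [p [Sp pm ->]] [p' [Sp' pm' ->]].
  have h0 : 0 < Q ^+ 2 / 2 by exact: divr_gt0.
  rewrite -(@ler_pM2r _ ((Q ^+ 2 / 2) ^+ e)) ?exprn_gt0 //.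
  have -> : 2 * A * 2 ^+ e * (delta * Q) * (Q ^+ 2 / 2) ^+ e
      = 2 * (A * delta * Q * (Q ^+ 2) ^+ e).
    by rewrite expr_div_n; field; rewrite expf_neq0.
  rewrite intr_norm rmorphB /=.
  apply: (@le_trans _ _ (`|(sqnorm p.1)%:~R - (sqnorm p'.1)%:~R|
                         * (sqnorm p'.1)%:~R ^+ e)).
    apply: ler_wpM2l => //; apply: lerXn2r; rewrite ?nnegrE ?ler0z ?sqnorm_ge0 //.
      exact: ltW.
    exact: Slow.
  apply: (le_trans (ler_normB_exprn e _ _)); rewrite ?ler0z ?sqnorm_ge0 //.
  move: Sp Sp' => [+ _] [+ _]; rewrite /region /= pm pm' !ler_norml.
  move: (_%:~R ^+ _) (_%:~R ^+ _) => x1 x2.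
  move=> /andP[a1 a2] /andP[b1 b2]; apply/andP; split; lra.
move=> s [p0 [[rp0 _] _ ->]].
have [n en] : exists n : nat, sqnorm p0.1 = n.
  by exists (absz (sqnorm p0.1)); rewrite gez0_abs // sqnorm_ge0.
rewrite en; apply: (@atmost_inj _ _ _ fst _ [set k | box (K1 * Q) k /\ sqnorm k = n]).
- by move=> p [[[rp _] _] sp]; split => //; exact: (region_box Q1 dbd rp).
- by move=> [k1 m1] [k2 m2] [[_ /= ->] _] [[_ /= ->] _] ->.
apply: (atmost_sphere N0 Krz ab) => s' s'n; apply: two; first by lra.
apply: (@le_trans _ _ n%:R); first by rewrite ler_nat.
have := region_sqnorm Q1 dbd rp0; rewrite en => /le_trans; apply.
apply: ler_wpM2l => //; rewrite mulnC exprM.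
by apply: lerXn2r; rewrite ?nnegrE ?exprn_ge0 //; exact: ltW.
Qed.

Lemma atmost_region (a b : I) : a != b -> exists2 K : R, 0 < K &
  forall Q delta : R, 1 <= Q -> 0 < delta < 1 ->
  atmost (region Q delta) (K * Q ^+ #|I| * (1 + delta * Q)).
Proof.
move=> ab.
have [Kd Kd0 dyadic] := atmost_region_dyadic.
have [Kl Kl0 low] := atmost_region_low ab.
exists (Kd * 2 + Kl) => [|Q delta Q1 dbd]; first by rewrite addr_gt0 // mulr_gt0.
have two_gt m : 0 < 2 ^+ m :> R by exact: exprn_gt0.
have exN : exists N, Q < (2 ^+ N) ^+ e.+1.
  exists (Num.truncn Q).+1; apply: lt_le_trans (truncnS_gt Q) _.
  apply: (@le_trans _ _ (2 ^+ (Num.truncn Q).+1)).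
    by rewrite -natrX ler_nat ltnW // ltn_expl.
  by rewrite -[leLHS]expr1; apply: ler_weXn2l => //; rewrite exprn_ege1 // ler1n.
(* [N] is the first index at which [w = 2 ^ N] leaves the dyadic range; [z = 2 ^ N] then suits the
   low part. *)
pose N := ex_minn exN.
have [QN minN] : Q < (2 ^+ N) ^+ e.+1
    /\ forall i, (i < N)%N -> (2 ^+ i) ^+ e.+1 <= Q.
  rewrite /N; case: ex_minnP => m hm hmin; split => // i im; rewrite leNgt.
  by apply/negP => /hmin; rewrite leqNgt im.
have N0 : (0 < N)%N.
  by rewrite lt0n; apply/eqP => N0; move: QN; rewrite N0 !expr1n ltNge Q1.
pose Z := Q ^+ #|I| * (1 + delta * Q).
have Z0 : 0 <= Z.
  move: dbd => /andP[/ltW d0 _]; rewrite mulr_ge0 ?exprn_ge0 ?addr_ge0 ?mulr_ge0 //;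
  exact: le_trans Q1.
pose F i := [set p | [/\ region Q delta p, B * Q ^+ 2 < `|p.2|%:~R * (2 * 2 ^+ i)
                    & `|p.2|%:~R * 2 ^+ i <= B * Q ^+ 2]].
have hF i : i \in iota 0 N -> atmost (F i) (Kd * Z / 2 ^+ i).
  rewrite mem_iota add0n => /andP[_ iN]; rewrite /Z mulrA.
  by apply: dyadic => //; [rewrite exprn_ege1 // ler1n | exact: minN].
have hL := low Q delta (2 ^+ N) Q1 dbd.
have {}hL : atmost [set p | region Q delta p /\ `|p.2|%:~R * 2 ^+ N <= B * Q ^+ 2]
    (Kl * Z).
  rewrite /Z mulrA; apply: hL => //.
    by rewrite -[leLHS]expr1; apply: ler_weXn2l => //; rewrite ler1n.
  have -> : 2 ^+ N / 2 = 2 ^+ N.-1 :> R.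
    by rewrite -[X in 2 ^+ X / _](prednK N0) exprSr mulfK.
  by apply: minN; rewrite prednK.
apply: (atmost_le (atmostU (atmost_bigU hF) hL)).
  move=> p rp.
  have [hp|hp] := leP (`|p.2|%:~R * 2 ^+ N) (B * Q ^+ 2); [by right | left].
  (* The piece containing [p] is the least [i] whose lower bound on the height holds; minimality
     gives the upper bound, and [region_height] does so when [i = 0]. *)
  have exi : exists i, B * Q ^+ 2 < `|p.2|%:~R * 2 ^+ i.+1.
    by exists N.-1; rewrite prednK.
  have iN : (ex_minn exi < N)%N.
    case: ex_minnP => m _ hmin; rewrite -[N in (_ < N)%N]prednK // ltnS.
    by apply: hmin; rewrite prednK.
  exists (ex_minn exi); first by rewrite mem_iota.
  move: iN; case: ex_minnP => -[|m] hm hmin _; split => //; rewrite -?exprS //.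
    by rewrite expr0 mulr1; exact: (region_height Q1 dbd rp).
  by rewrite leNgt; apply/negP => /hmin; rewrite ltnn.
rewrite -mulrA mulrDl lerD2r -/Z -mulr_sumr [Kd * 2 * Z]mulrAC.
apply: ler_wpM2l; first by apply: mulr_ge0 => //; exact: ltW.
suff -> : \sum_(i <- iota 0 N) (2 ^+ i)^-1 = 2 - 2 / 2 ^+ N :> R.
  by rewrite lerBlDr lerDl divr_ge0 // ltW.
elim: (N) => [|m IH]; first by rewrite big_nil expr0 divr1 subrr.
rewrite -addn1 iotaD big_cat /= big_seq1 IH add0n addn1 exprS.
by field; exact: lt0r_neq0.
Qed.

End Region.

(** * Pairs of lattice points at gauge distance close to [Q] *)

Lemma normB_exprn_le (R : realDomainType) (m : nat) (x y M : R) :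
  0 <= x <= M -> 0 <= y <= M ->
  `|x ^+ m.+1 - y ^+ m.+1| <= `|x - y| * (m.+1%:R * M ^+ m).
Proof.
move=> /andP[x0 xM] /andP[y0 yM]; rewrite subrXX normrM ler_wpM2l //.
rewrite ger0_norm; last by rewrite sumr_ge0 // => i _; rewrite mulr_ge0 ?exprn_ge0.
rewrite mulr_natl -[m.+1 in leRHS]card_ord -sumr_const; apply: ler_sum => i _.
rewrite /= -[X in M ^+ X](subnK (leq_ord i)) exprD.
by rewrite ler_pM ?exprn_ge0 // lerXn2r // nnegrE // (le_trans x0).
Qed.

Section Pairs.
Variables (R : realType) (n : nat).
Implicit Types (u v : 'cV[int]_(n + n + 1)).

Definition hcoords u : {ffun 'I_(n + n) -> int} := [ffun i => usubmx u i 0].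

Definition hdiff u v : {ffun 'I_(n + n) -> int} :=
  [ffun i => hcoords u i - hcoords v i].

(* Twice the last coordinate of [u * v^-1], which is an integer. *)
Definition vdiff2 u v : int :=
  2 * (dsubmx u 0 0 - dsubmx v 0 0)
  + ((usubmx v)^T *m block_mx 0 1%:M (- 1%:M) 0 *m usubmx u) 0 0.

Lemma hvcoords_inj u v : hcoords u = hcoords v -> dsubmx u 0 0 = dsubmx v 0 0 -> u = v.
Proof.
move=> huv duv; rewrite -[u]vsubmxK -[v]vsubmxK; congr col_mx; apply/matrixP => i j.
  by move/ffunP/(_ i): huv; rewrite !ffunE (ord1 j).
by rewrite (ord1 i) (ord1 j).
Qed.

Lemma atmost_lattice (c : R) : 0 < c -> exists2 K : R, 0 < K &
  forall Q : nat, (1 <= Q)%N -> atmost (@lattice R n c Q) (K * Q%:R ^+ (2 * n + 2)).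
Proof.
move=> c0; exists ((1 + 2 * c) ^+ (n + n).+1) => [|Q Q1].
  by rewrite exprn_gt0 // addr_gt0 // mulr_gt0.
have Q1R : 1 <= Q%:R :> R by rewrite ler1n.
have cQ0 m : 0 <= c * Q%:R ^+ m by rewrite mulr_ge0 ?exprn_ge0 // ltW.
have le m : 1 + 2 * (c * Q%:R ^+ m) <= (1 + 2 * c) * Q%:R ^+ m.
  have : 1 <= Q%:R ^+ m :> R by exact: exprn_ege1.
  by move: (_ ^+ m) => X; lra.
have pos m : 0 <= 1 + 2 * (c * Q%:R ^+ m) by rewrite addr_ge0 // mulr_ge0.
apply: (@atmost_le _ _ _ _ _
  ((1 + 2 * (c * Q%:R ^+ 1)) ^+ #|'I_(n + n)| * (1 + 2 * (c * Q%:R ^+ 2)))); last 2 first.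
- by move=> u h; exact: h.
- rewrite card_ord; apply: (@le_trans _ _
    (((1 + 2 * c) * Q%:R ^+ 1) ^+ (n + n) * ((1 + 2 * c) * Q%:R ^+ 2))).
    apply: ler_pM => //; first exact: exprn_ge0.
    by apply: lerXn2r => //; rewrite nnegrE // (le_trans (pos 1%N)).
  rewrite expr1 exprMn mulrACA -exprSr -exprD.
  by rewrite mul2n -addnn.
have hB := @atmost_box R 'I_(n + n) _ (cQ0 1%N).
apply: (@atmost_fiber _ _ _ hcoords _ _ _ _ _ _ hB) => //.
  by move=> u [hu _] i; rewrite ffunE expr1; exact: hu.
move=> k _; apply: (@atmost_inj _ _ _ (fun u => dsubmx u 0 0) _ _ _ _ _
  (atmost_int_ball (cQ0 2%N))).
  by move=> u [[_ hu] _].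
by move=> u v [_ <-] [_ /esym huv]; exact: hvcoords_inj.
Qed.

(** Replacing the vertical coordinate by its integral double [vdiff2] divides [C] by
    [2 ^ (e + 1)]. *)
Lemma phiX (e : nat) (C : R) u v : 0 < C ->
  phi (2 * e.+1)%:R C (map_mx intr u) (map_mx intr v) ^+ (2 * e.+1)
  = (sqnorm (hdiff u v))%:~R ^+ e.+1
    + C / 2 ^+ e.+1 * `|vdiff2 u v|%:~R ^+ e.+1.
Proof.
move=> C0; rewrite phiE.
have -> : (2 * e.+1)%:R / 2 = e.+1%:R :> R by rewrite mulnC natrM mulfK.
rewrite !powR_mulrn //; last by rewrite sqrtr_ge0.
rewrite -powR_mulrn ?powR_ge0 // -powRrM mulVf ?pnatr_eq0 // powRr1; last first.
  by rewrite addr_ge0 ?mulr_ge0 ?exprn_ge0 ?sqrtr_ge0 // ltW.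
congr (_ + _).
  rewrite exprM sqr_sqrtr; last by rewrite sumr_ge0 // => i _; exact: sqr_ge0.
  congr (_ ^+ _); rewrite /sqnorm rmorph_sum /=; apply: eq_bigr => i _.
  by rewrite !mxE !ffunE rmorphXn rmorphB /= !mxE.
rewrite -[RHS]mulrA; congr (_ * _).
rewrite -exprVn -exprMn; congr (_ ^+ _).
rewrite -(@gtr0_norm _ (2^-1)) ?invr_gt0 // intr_norm -normrM; congr (`| _ |).
rewrite gtr0_norm ?invr_gt0 //.
have hp w : hpart (map_mx intr w) = map_mx intr (usubmx w) :> 'cV[R]_(n + n).
  by apply/matrixP => i j; rewrite !mxE.
have vp w : vpart (map_mx intr w) = (dsubmx w 0 0)%:~R :> R by rewrite /vpart !mxE.
have -> : Jmx = map_mx intr (block_mx 0 1%:M (- 1%:M) 0) :> 'M[R]_(n + n).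
  by rewrite /Jmx map_block_mx map_mxN map_mx1 !map_mx0.
rewrite !hp !vp map_trmx -!map_mxM [(map_mx _ _) 0 0]mxE.
rewrite /vdiff2 rmorphD rmorphM rmorphB /=.
by rewrite mulrDr mulKf.
Qed.

(** Since [delta < 1 <= Q], the gauge is at most [2 * Q], so passing to powers of exponent
    [alpha = 2 * (e + 1)] costs a factor [alpha * (2 * Q) ^ (alpha - 1)]. *)
Lemma near_pairs_region (e : nat) (C c : R) (Q : nat) (delta : R) u v :
  0 < C -> (1 <= Q)%N -> 0 < delta < 1 ->
  @near_pairs R n (2 * e.+1)%:R C c Q delta (u, v) ->
  region e ((2 * e.+1)%:R * 2 ^+ (2 * e).+1) (C / 2 ^+ e.+1) Q%:R delta
    (hdiff u v, vdiff2 u v).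
Proof.
move=> C0 Q1 /andP[d0 d1] [_ _ /=].
have Q1R : 1 <= Q%:R :> R by rewrite ler1n.
rewrite /region /= -phiX // -!exprM.
set f := phi _ _ _ _ => hf.
have f0 : 0 <= f by exact: powR_ge0.
have -> : (2 * e.+1 = (2 * e).+2)%N by rewrite mulnS.
apply: (le_trans (@normB_exprn_le _ (2 * e).+1 f Q%:R (2 * Q%:R) _ _)).
- by move: hf; rewrite f0 ler_norml /= => /andP[_]; lra.
- by rewrite ler0n /=; lra.
rewrite exprMn (exprS Q%:R (2 * e)).
set X := Q%:R ^+ _; set Y := 2 ^+ _; set m := (_%:R : R).
have -> : m * Y * delta * Q%:R * X = delta * (m * (Y * (Q%:R * X))) by ring.
by apply: ler_wpM2r => //; rewrite !mulr_ge0 // exprn_ge0.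
Qed.

(** With [v] fixed, [hdiff] gives the horizontal part of [u], hence the symplectic term, and the
    vertical coordinate follows. *)
Lemma hdiff_inj u u' v : hdiff u v = hdiff u' v -> vdiff2 u v = vdiff2 u' v -> u = u'.
Proof.
move=> hd vd.
have hc i : hcoords u i = hcoords u' i.
  by have /ffunP/(_ i) := hd; rewrite !ffunE => /addIr.
apply: hvcoords_inj; first by apply/ffunP.
have eu : usubmx u = usubmx u'.
  by apply/matrixP => i j; have := hc i; rewrite !ffunE (ord1 j).
by move: vd; rewrite /vdiff2 eu => /addIr; lia.
Qed.

Lemma atmost_near_pairs (e : nat) (C c : R) : (1 <= n)%N -> 0 < C -> 0 < c ->
  exists2 K : R, 0 < K & forall (Q : nat) (delta : R), (1 <= Q)%N -> 0 < delta < 1 ->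
  atmost (@near_pairs R n (2 * e.+1)%:R C c Q delta)
    (K * Q%:R ^+ (2 * n + 2) * (Q%:R ^+ (2 * n) * (1 + delta * Q%:R))).
Proof.
move=> n1 C0 c0.
have [Kl Kl0 lat] := atmost_lattice c0.
(* As [n >= 1], there are two distinct horizontal coordinates for the count of sums of two
   squares. *)
have ab : lshift n (Ordinal n1) != rshift n (Ordinal n1) by rewrite eq_lrshift.
have A0 : 0 < (2 * e.+1)%:R * 2 ^+ (2 * e).+1 :> R by rewrite mulr_gt0 ?exprn_gt0.
have C'0 : 0 < C / 2 ^+ e.+1 by rewrite divr_gt0 ?exprn_gt0.
have [Kr Kr0 reg] := @atmost_region R _ e _ _ A0 C'0 _ _ ab.
exists (Kl * Kr) => [|Q delta Q1 dbd]; first exact: mulr_gt0.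
have Q1R : 1 <= Q%:R :> R by rewrite ler1n.
have Qnn : Q%:R ^+ (n + n) = Q%:R ^+ (2 * n) :> R by rewrite mul2n addnn.
have {}reg := reg Q%:R delta Q1R dbd; rewrite card_ord Qnn in reg.
have d0 : 0 <= delta by case/andP: dbd => /ltW.
have -> : Kl * Kr * Q%:R ^+ (2 * n + 2) * (Q%:R ^+ (2 * n) * (1 + delta * Q%:R))
    = Kl * Q%:R ^+ (2 * n + 2) * (Kr * Q%:R ^+ (2 * n) * (1 + delta * Q%:R)).
  move: (_ ^+ (2 * n + 2)) (_ ^+ (2 * n)) (1 + _) => x y z; ring.
apply: (@atmost_fiber _ _ _ snd _ (@lattice R n c Q)).
- by rewrite !mulr_ge0 ?addr_ge0 ?mulr_ge0 // ?exprn_ge0 // ltW.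
- by move=> [u v] [].
- exact: lat.
move=> v _; apply: (@atmost_inj _ _ _
  (fun p : 'cV[int]_(n + n + 1) * 'cV[int]_(n + n + 1) => (hdiff p.1 v, vdiff2 p.1 v))
  _ _ _ _ _ reg).
- by move=> [u v'] [h /= <-]; exact: near_pairs_region h.
- by move=> [u v1] [u' v2] [_ /= ->] [_ /= ->] [hd vd]; rewrite (hdiff_inj hd vd).
Qed.

End Pairs.

(** * Cardinality bound in both ranges of the exponent *)

Theorem theorem1p2 (R : realType) (n alpha : nat) (c C : R)
  (n_ge1 : (1 <= n)%N)
  (alpha_ge2 : (2 <= alpha)%N) (alpha_even : ~~ odd alpha)
  (alpha_neq4 : alpha <> 4%N)
  (c_gt0 : 0 < c) (C_gt0 : 0 < C)
  (C_subadditive : alpha <> 2%N -> forall x y : 'cV[R]_(n + n + 1),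
     hnorm alpha%:R C (hmul x y) <= hnorm alpha%:R C x + hnorm alpha%:R C y) :
  exists2 K : R, 0 < K &
    forall (delta : R) (Q : nat), 0 < delta < 1 -> (1 <= Q)%N ->
      Q%:R ^- (2 * n + 2)
        * (#|` fset_set (@near_pairs R n alpha%:R C c Q delta)|)%:R
      <= if alpha == 2%N
         then K * Num.max (Q%:R ^+ (2 * n)) (Q%:R ^+ (2 * n + 1) * delta)
         else K * Num.max (Q%:R `^ ((2 * n)%:R + 2 / (2 * n + 1)%:R))
                          (Q%:R ^+ (2 * n + 1) * delta).
Proof.
have [e alphaE] : exists e, alpha = (2 * e.+1)%N.
  exists (alpha./2.-1); rewrite prednK ?half_gt0 // mul2n.
  by rewrite -[LHS]odd_double_half (negbTE alpha_even).
have [K K0 count] := @atmost_near_pairs R n e C c n_ge1 C_gt0 c_gt0.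
exists (2 * K) => [|delta Q dbd Q1]; first by rewrite mulr_gt0.
have Q1R : 1 <= Q%:R :> R by rewrite ler1n.
have Q0 m : 0 < Q%:R ^+ m :> R by rewrite exprn_gt0 // (lt_le_trans ltr01).
have d0 : 0 <= delta by case/andP: dbd => /ltW.
(* One estimate serves both cases; the factor [2] bounds a sum of two terms by their maximum. *)
have main : Q%:R ^- (2 * n + 2)
    * (#|` fset_set (@near_pairs R n alpha%:R C c Q delta)|)%:R
    <= 2 * K * Num.max (Q%:R ^+ (2 * n)) (Q%:R ^+ (2 * n + 1) * delta).
  have fin := @finite_near_pairs R n alpha%:R C c Q delta.
  have cnt := count Q delta Q1 dbd; rewrite -alphaE in cnt.
  rewrite mulrC ler_pdivrMr //; apply: (le_trans (atmost_fset fin cnt)).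
  rewrite [leRHS]mulrC [K * _]mulrC -[leLHS]mulrA ler_pM2l // [2 * K]mulrC -mulrA.
  rewrite ler_pM2l // mulrDr mulr1 mulr_natl mulr2n.
  by rewrite lerD // le_max ?lexx // exprD expr1 [delta * _]mulrC mulrA lexx orbT.
(* For [alpha <> 2] the stated power of [Q >= 1] has the larger exponent
   [2 * n + 2 / (2 * n + 1)]. *)
case: ifP => // _; apply: (le_trans main); rewrite ler_wpM2l ?mulr_ge0 ?(ltW K0) //.
rewrite ge_max !le_max lexx orbT andbT; apply/orP; left.
rewrite -powR_mulrn //; apply: ler_powR => //.
by rewrite lerDl divr_ge0.
Qed.
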